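(* Let $\Delta\ge3$ be an integer and let $T$ be a tree of maximum degree $\Delta$ such that $\sigma_{LL}(T)\le\sigma_{LL}(T')$ for every tree $T'$ of maximum degree at most $\Delta$ with $|V_L(T')|=|V_L(T)|$. Let $v$ be a central node of $T$, and regard $T$ as rooted at $v$ (i.e. placed on levels $\mathbf{L}_0,\mathbf{L}_1,\dots$ with node $w$ on level $d_T(v,w)$). Then (with a suitable left-to-right ordering of children) $T\in\mathfrak{T}(\Delta,\Delta)$ as a tree rooted at $v$, and for every node $u\neq v$ the subtree $T_u$, rooted at $u$, belongs to $\mathfrak{T}(\Delta-1,\Delta)$.
   Context: For a tree $T$, $V_L(T)$ is its set of leaves, $d_T$ the path distance, and $\sigma_{LL}(T)=\sum_{\{x,y\}\subseteq V_L(T),\,x\ne y} d_T(x,y)$. A node $v$ of a tree with $n$ nodes is central if every component of $T-v$ has at most $n/2$ nodes. For $T$ rooted at $v$ and $u\neq v$, $T_u$ is the subtree consisting of all nodes $w$ such that $u$ lies on the path from $w$ to $v$. For integers $\Delta\ge3$, $\mathcal{R}\in\{\Delta,\Delta-1\}$ put $M_0=1$ and $M_k=1+\mathcal{R}+\mathcal{R}(\Delta-1)+\dots+\mathcal{R}(\Delta-1)^{k-1}$ for $k\ge1$. The family $\mathfrak{T}(\mathcal{R},\Delta)$ contains, for each $n\ge1$, exactly one rooted tree with $n$ nodes (up to isomorphism), defined as follows: let $M_k\le n<M_{k+1}$; nodes lie on levels $\mathbf{L}_0,\dots,\mathbf{L}_{k+1}$ with children ordered left to right; the root on $\mathbf{L}_0$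 has $\min\{n-1,\mathcal{R}\}$ children; for $1\le i\le k-1$ every node on $\mathbf{L}_i$ has exactly $\Delta-1$ children; writing $n-M_k=m(\Delta-1)+r$ with $0\le r<\Delta-1$, the $m$ leftmost nodes on $\mathbf{L}_k$ each have $\Delta-1$ children, the $(m+1)$-st node from the left on $\mathbf{L}_k$ has $r$ children, and no other node on $\mathbf{L}_k$ has children. *)

(* Defs.v *)
From mathcomp Require Export all_boot.

Set Implicit Arguments.
Unset Strict Implicit.
Unset Printing Implicit Defensive.

Section Graphs.

Variables (V : finType) (e : rel V).

(* A cycle is a cyclic sequence of at least three distinct nodes; [ucycle]
   alone also holds for an edge traversed back and forth. *)
Definition is_tree : Prop :=
  [/\ symmetric e, irreflexive e, 0 < #|V|,
      (forall x y, connect e x y)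
    & (forall c : seq V, ucycle e c -> size c <= 2)].

Definition degree (x : V) : nat := #|[set y | e x y]|.

Definition max_degree : nat := \max_(x : V) degree x.

Definition leaves : {set V} := [set x | degree x == 1].

Definition walk_of_length (x y : V) (n : nat) : bool :=
  [exists p : n.-tuple V, path e x p && (last x p == y)].

(* Least length of a walk; the search range suffices when x and y are
   connected, and the value is #|V| otherwise. *)
Definition dist (x y : V) : nat := find (walk_of_length x y) (iota 0 #|V|).

(* [enum_rank] only serves to count each unordered pair once. *)
Definition sigma_LL : nat :=
  \sum_(x in leaves) \sum_(y in leaves | enum_rank x < enum_rank y) dist x y.

Definition component_without (v x : V) : {set V} :=
  [set y | connect [rel a b | [&& a != v, b != v & e a b]] x y].

Definition central (v : V) : Prop :=
  forall x, x != v -> 2 * #|component_without v x| <= #|V|.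

(* u lies on a simple path from w to v; such a path w :: p has fewer than #|V|
   edges, so the bound on its length is harmless. *)
Definition on_path (w v u : V) : bool :=
  [exists n : 'I_#|V|, exists p : n.-tuple V,
    [&& path e w p, last w p == v, uniq (w :: p) & u \in w :: p]].

Definition subtree (v u : V) : {set V} := [set w | on_path w v u].

Definition induced (A : {set V}) : rel {x : V | x \in A} :=
  fun x y => e (val x) (val y).

Variable root : V.

Definition level (x : V) : nat := dist root x.

Definition children (x : V) : {set V} :=
  [set y | e x y && (level y == (level x).+1)].

(* Orderings of the children of every node, given as the left-to-right orders
   they induce on the levels; [lt] is only meaningful inside a level. *)
Definition left_to_right (lt : rel V) : Prop :=
  [/\ irreflexive lt,
      (forall x y z, level x = level y -> level y = level z ->
         lt x y -> lt y z -> lt x z),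
      (forall x y, level x = level y -> x != y -> lt x y || lt y x)
    & (forall x y x' y', level x = level y -> lt x y ->
         x' \in children x -> y' \in children y -> lt x' y')].

Definition position (lt : rel V) (x : V) : nat :=
  #|[set y | (level y == level x) && lt y x]|.

End Graphs.

Arguments induced {V} e A x y.

Definition M (R Delta k : nat) : nat := 1 + \sum_(i < k) R * Delta.-1 ^ i.

(* Membership of the tree e rooted at root in the family T(R, Delta), the
   children being ordered by lt. Positions are counted from 0. *)
Definition in_family (R Delta : nat) (V : finType) (e : rel V) (root : V)
    (lt : rel V) : Prop :=
  [/\ is_tree e, left_to_right e root lt
    & exists k : nat,
      let m := (#|V| - M R Delta k) %/ Delta.-1 in
      let r := (#|V| - M R Delta k) %% Delta.-1 in
      [/\ M R Delta k <= #|V| < M R Delta k.+1,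
          (forall w, level e root w <= k.+1),
          #|children e root root| = minn (#|V| - 1) R,
          (forall w, 1 <= level e root w <= k.-1 ->
             #|children e root w| = Delta.-1)
        & (forall w, level e root w = k ->
             #|children e root w| =
               if position e root lt w < m then Delta.-1
               else if position e root lt w == m then r else 0)]].

(* Main.v *)
Require Import Defs.
From mathcomp Require Import all_boot.
From mathcomp Require Import zify.

Set Implicit Arguments.
Unset Strict Implicit.
Unset Printing Implicit Defensive.

(** Write b = Delta - 1, let L be the number of leaves, and root T at a node
    below each of whose neighbours there are at most L/2 leaves. With l(u) the
    number of leaves below u, sigma_LL(T) is the sum of l(u)(L - l(u)) over
    u <> root, and x(L - x) is, for x <= L/2, a sum of functions min(x, t) with
    t <= L/2. So it suffices to compare the sums S_t of the min(l(u), t) with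
    those of the tree G of the family that has L leaves (a b-ary heap).

    Cutting T at the a + 1 top nodes (the root and the nodes with l(u) > t)
    shows S_t = t a + E, where E is the sum of the depths of the leaves in a
    forest of at most (a + 1)(b - 1) + 2 trees. Kraft's inequality, linearised
    at a depth k, bounds E from below, and the defect in this bound is a sum of
    local nonnegative slacks. In G, cut at any a + 1 top nodes, the total slack
    is less than b - 1 for a suitable k; by integrality E is then minimal, and
    S_t(G) <= S_t(T). If T is optimal, equality holds for all t <= L/2, hence
    every such forest of T has total slack less than b - 1 too. This forces the
    leaves onto two consecutive levels, and at most one node per level whose
    subtree is neither completely filled nor empty on the last level.

    Equality for t = 1 also gives |T| = |G|, from which a node that is central
    with respect to the nodes is central with respect to the leaves. *)

(** * Rooted trees *)

Record rooted_tree (V : finType) (e : rel V) (root : V) := RootedTree {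
  parent : V -> V;
  depth : V -> nat;
  depth_root : depth root = 0;
  depth_parent : forall x, x != root -> depth x = (depth (parent x)).+1;
  edgeE : forall x y,
    e x y = (x != root) && (parent x == y) || (y != root) && (parent y == x) }.

Section Ancestors.

Variables (V : finType) (e : rel V) (root : V) (T : rooted_tree e root).
Implicit Types u w x y : V.

Local Notation parent := (parent T).
Local Notation depth := (depth T).

Lemma rooted_ind (P : V -> Prop) :
  P root -> (forall x, x != root -> P (parent x) -> P x) -> forall x, P x.
Proof.
move=> P_root P_step x; have [n] := ubnP (depth x); elim: n x => // n IHn x xn.
have [-> // | xr] := eqVneq x root; apply/P_step/IHn => //.
by rewrite (depth_parent T xr) in xn.
Qed.

Lemma depth_eq0 x : (depth x == 0) = (x == root).
Proof.
apply/eqP/eqP => [x0 | ->]; last exact: depth_root.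
by apply/eqP; apply: contra_eqT x0 => /(depth_parent T) ->.
Qed.

Lemma depth_gt0 x : (0 < depth x) = (x != root).
Proof. by rewrite lt0n depth_eq0. Qed.

Lemma parent_neq x : x != root -> parent x != x.
Proof. by move=> xr; apply: contra_eq_neq (depth_parent T xr) => ->; lia. Qed.

Definition kids x : {set V} := [set y | (y != root) && (parent y == x)].

Definition childless x : bool := kids x == set0.

Lemma kidP x y : reflect (y != root /\ parent y = x) (y \in kids x).
Proof. by rewrite inE; apply: (iffP andP) => -[yr /eqP]. Qed.

Lemma kid_of_parent x : x != root -> x \in kids (parent x).
Proof. by move=> xr; apply/kidP. Qed.

Lemma depth_kid x y : y \in kids x -> depth y = (depth x).+1.
Proof. by case/kidP => yr <-; apply: depth_parent. Qed.

Lemma kid_internal x y : y \in kids x -> ~~ childless x.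
Proof. by move=> yx; apply/set0Pn; exists y. Qed.

Lemma card_kids_eq0 x : (#|kids x| == 0) = childless x.
Proof. exact: cards_eq0. Qed.

Lemma sum_parent (F : V -> nat) :
  \sum_(w | w != root) F (parent w) = \sum_x #|kids x| * F x.
Proof.
rewrite (partition_big parent xpredT) //=; apply: eq_bigr => x _.
rewrite -sum_nat_const; apply: eq_big => [w | w /andP[_ /eqP -> //]].
by rewrite inE.
Qed.

Definition ancestor u w : bool :=
  (depth u <= depth w) && (iter (depth w - depth u) parent w == u).

Definition descendants u : {set V} := [set w | ancestor u w].

Lemma ancestor_refl x : ancestor x x.
Proof. by rewrite /ancestor leqnn subnn eqxx. Qed.

Lemma leq_ancestor u w : ancestor u w -> depth u <= depth w.
Proof. by case/andP. Qed.

Lemma ancestor_same_depth u w : depth u = depth w -> ancestor u w = (u == w).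
Proof. by move=> uw; rewrite /ancestor uw leqnn subnn eq_sym. Qed.

Lemma ancestorE u w :
  ancestor u w = (u == w) || (w != root) && ancestor u (parent w).
Proof.
have [-> | uw] /= := eqVneq u w; first exact: ancestor_refl.
have [wr | wr] /= := eqVneq w root.
  rewrite wr in uw *.
  by rewrite /ancestor depth_root leqn0 depth_eq0 (negPf uw).
rewrite /ancestor (depth_parent T wr).
case: (ltngtP (depth u) (depth (parent w)).+1) => [le_u_pw | lt_pw_u | ->].
- by rewrite -[depth u <= _]/(depth u < _.+1) le_u_pw subSn // iterSr.
- by rewrite leqNgt ltnW.
- by rewrite subnn ltnn eq_sym (negPf uw).
Qed.

Lemma ancestor_count u w : w != root ->
  ancestor u w = (u == w) + ancestor u (parent w) :> nat.
Proof.
move=> wr; rewrite ancestorE wr; case: eqP => //= ->.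
by rewrite /ancestor (depth_parent T wr) ltnn.
Qed.

Lemma root_ancestor w : ancestor root w.
Proof.
elim/rooted_ind: w => [| w wr IHw]; first exact: ancestor_refl.
by rewrite ancestorE wr IHw orbT.
Qed.

Lemma ancestor_root u : ancestor u root = (u == root).
Proof. by rewrite ancestorE eqxx orbF. Qed.

Lemma ancestor_neq_root u w : u != root -> ancestor u w -> w != root.
Proof. by move=> ur; apply: contraTneq => ->; rewrite ancestor_root. Qed.

Lemma ancestor_trans : transitive ancestor.
Proof.
move=> x u w ux; elim/rooted_ind: w => [| w wr IHw].
  by rewrite ancestor_root => /eqP <-.
rewrite ancestorE wr => /orP[/eqP <- // | /IHw uw].
by rewrite ancestorE wr uw orbT.
Qed.

Lemma ancestor_kid x y : y \in kids x -> ancestor x y.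
Proof. by case/kidP => yr <-; rewrite ancestorE yr ancestor_refl orbT. Qed.

Lemma ancestor_parent u w : ancestor u w -> u != w -> ancestor u (parent w).
Proof. by rewrite ancestorE => /orP[-> // | /andP[]]. Qed.

Lemma ltn_ancestor u w : ancestor u w -> u != w -> depth u < depth w.
Proof.
move=> uw neq_uw; rewrite ltn_neqAle leq_ancestor // andbT.
by apply: contraNneq neq_uw => /ancestor_same_depth <-.
Qed.

Lemma ancestor_anti u w : ancestor u w -> ancestor w u -> u = w.
Proof.
move=> uw wu; apply/eqP; rewrite -ancestor_same_depth //.
by apply/eqP; rewrite eqn_leq !leq_ancestor.
Qed.

Lemma ancestor_kids u w :
  ancestor u w = (u == w) + \sum_(y in kids u) ancestor y w :> nat.
Proof.
elim/rooted_ind: w => [| w wr IHw].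
  rewrite ancestor_root big1 ?addn0 // => y /kidP[yr _].
  by rewrite ancestor_root (negPf yr).
rewrite ancestor_count // IHw; congr (_ + _).
under [RHS]eq_bigr => y _ do rewrite ancestor_count //.
rewrite big_split /=; congr (_ + _).
have [wu | wu] := boolP (w \in kids u).
  rewrite (bigD1 w) //= eqxx big1 ?addn0 => [|y /andP[_ /negPf ->] //].
  by case/kidP: wu => _ ->; rewrite eqxx.
rewrite big1 => [|y yu]; last by case: eqP wu => // <-; rewrite yu.
by case: eqP wu => // ->; rewrite kid_of_parent.
Qed.

Lemma ancestor_kid_root w :
  w != root -> exists2 u, u \in kids root & ancestor u w.
Proof.
elim/rooted_ind: w => [| w wr IHw _]; first by rewrite eqxx.
have [pr | /IHw[u ur uw]] := eqVneq (parent w) root.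
  by exists w; rewrite ?ancestor_refl // -pr kid_of_parent.
by exists u; rewrite // ancestorE wr uw orbT.
Qed.

Lemma sum_ancestor_depth x : \sum_(u | u != root) ancestor u x = depth x.
Proof.
elim/rooted_ind: x => [| x xr IHx].
  by rewrite depth_root big1 // => u /negPf; rewrite ancestor_root => ->.
under eq_bigr => u _ do rewrite ancestor_count //.
rewrite big_split /= IHx (depth_parent T xr) (bigD1 x) //= eqxx big1 //.
by move=> u /andP[_ /negPf ->].
Qed.

Definition leaf_count u : nat := \sum_(w | childless w) ancestor u w.

Lemma leaf_count_kids u :
  leaf_count u = childless u + \sum_(y in kids u) leaf_count y.
Proof.
rewrite /leaf_count; under eq_bigr => w _ do rewrite ancestor_kids.
rewrite big_split /= exchange_big; congr (_ + _).
have [u0 | u0] := boolP (childless u).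
  rewrite (bigD1 u) //= eqxx big1 // => w /andP[_ /negPf].
  by rewrite eq_sym => ->.
by rewrite big1 // => w w0; case: eqP u0 => // ->; rewrite w0.
Qed.

Lemma leaf_count_childless u : childless u -> leaf_count u = 1.
Proof. by move=> u0; rewrite leaf_count_kids u0 (eqP u0) big_set0. Qed.

Lemma leaf_count_internal u :
  ~~ childless u -> leaf_count u = \sum_(y in kids u) leaf_count y.
Proof. by rewrite leaf_count_kids => /negPf ->. Qed.

Lemma childless_descendant x : exists2 y, ancestor x y & childless y.
Proof.
case: (@arg_maxnP _ x (ancestor x) depth (ancestor_refl x)) => y xy ymax.
exists y => //; apply: contraT => /set0Pn[z zy].
have : depth z <= depth y := ymax z (ancestor_trans xy (ancestor_kid zy)).
by rewrite (depth_kid zy) ltnn.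
Qed.

Lemma leaf_count_gt0 u : 0 < leaf_count u.
Proof.
have [y uy y0] := childless_descendant u.
by rewrite /leaf_count (bigD1 y) //= uy.
Qed.

Lemma leq_leaf_count u w : ancestor u w -> leaf_count w <= leaf_count u.
Proof.
move=> uw; apply: leq_sum => x _; case: (boolP (ancestor w x)) => // wx.
by rewrite (ancestor_trans uw wx).
Qed.

Lemma leaf_count_root : leaf_count root = #|[set x | childless x]|.
Proof.
by rewrite -sum1dep_card; apply: eq_bigr => w _; rewrite root_ancestor.
Qed.

Lemma leaf_count_le_root u : leaf_count u <= leaf_count root.
Proof. exact/leq_leaf_count/root_ancestor. Qed.

Lemma card_kids_le_leaf_count u : #|kids u| <= leaf_count u.
Proof.
rewrite leaf_count_kids -sum1_card; apply: leq_trans (leq_addl _ _).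
by apply: leq_sum => y _; apply: leaf_count_gt0.
Qed.

Lemma sum_ancestor (F : {set V}) u :
  \sum_(w in F) ancestor u w = #|F :&: descendants u|.
Proof.
rewrite -sum1_card big_mkcond [RHS]big_mkcond; apply: eq_bigr => w _.
by rewrite !inE; case: (w \in F); case: ancestor.
Qed.

Lemma leaf_countE u :
  leaf_count u = #|[set x | childless x] :&: descendants u|.
Proof. by rewrite -sum_ancestor; apply: eq_bigl => w; rewrite inE. Qed.

Lemma parent_edge x : x != root -> e x (parent x).
Proof. by move=> xr; rewrite (edgeE T) xr eqxx. Qed.

Lemma edge_to_parent x y :
  e x y -> depth y <= depth x -> x != root /\ parent x = y.
Proof.
rewrite (edgeE T) => /orP[/andP[xr /eqP <-] // | /andP[yr /eqP <-]].
by rewrite (depth_parent T yr) ltnn.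
Qed.

Lemma rooted_tree_sym : symmetric e.
Proof. by move=> x y; rewrite !(edgeE T) orbC. Qed.

Lemma rooted_tree_irr : irreflexive e.
Proof.
move=> x; apply/negP => /edge_to_parent /(_ (leqnn _))[xr].
by apply/eqP/parent_neq.
Qed.

Lemma connect_to_root x : connect e x root.
Proof.
elim/rooted_ind: x => [| x xr]; first exact: connect0.
exact/connect_trans/connect1/parent_edge.
Qed.

(* Both neighbours, along a cycle, of a deepest node are its parent. *)
Lemma rooted_tree_acyclic (c : seq V) : ucycle e c -> size c <= 2.
Proof.
case: c => // x0 c0; set c := x0 :: c0 => /andP[c_cycle c_uniq].
case: (@arg_maxnP _ x0 (mem c) depth (mem_head _ _)) => x xc x_max.
have [n p cE] := rot_to xc; rewrite -(size_rot n) cE.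
have {}x_max y : y \in x :: p -> depth y <= depth x.
  by rewrite -cE mem_rot; apply: x_max.
move: c_cycle c_uniq; rewrite -(rot_cycle n) -(rot_uniq n) {}cE.
case/lastP: p x_max => [// | p z] x_max.
rewrite [cycle _ _]/= rcons_path last_rcons => /andP[p_path zx].
have [_ pz] : x != root /\ parent x = z.
  apply: edge_to_parent; first by rewrite rooted_tree_sym.
  by apply: x_max; rewrite inE mem_rcons mem_head orbT.
case: p p_path x_max => // y p /andP[xy _] x_max /and3P[_ yp _].
have [_ py] : x != root /\ parent x = y.
  by apply: edge_to_parent => //; apply: x_max; rewrite !inE eqxx orbT.
by rewrite -py pz mem_rcons mem_head in yp.
Qed.

Lemma rooted_tree_is_tree : is_tree e.
Proof.
split; [exact: rooted_tree_sym | exact: rooted_tree_irr | | |].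
- by apply/card_gt0P; exists root.
- move=> x y; apply: connect_trans (connect_to_root x) _.
  by rewrite (sym_connect_sym rooted_tree_sym); apply: connect_to_root.
- exact: rooted_tree_acyclic.
Qed.

End Ancestors.

Arguments rooted_ind {V e root} T P.

Section Walks.

Variables (V : finType) (e : rel V).
Implicit Types x y : V.

Lemma walkP x y n :
  reflect (exists p, [/\ path e x p, last x p = y & size p = n])
          (walk_of_length e x y n).
Proof.
apply: (iffP existsP) => [[p /andP[xp /eqP py]] | [p [xp py <-]]].
  by exists p; rewrite size_tuple.
by exists (in_tuple p); rewrite /= xp py eqxx.
Qed.

Lemma walk_cons x y z n :
  e x y -> walk_of_length e y z n -> walk_of_length e x z n.+1.
Proof.
move=> xy /walkP[p [yp pz <-]]; apply/walkP; exists (y :: p).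
by rewrite /= xy yp pz.
Qed.

Lemma walk_rcons x y z n :
  walk_of_length e x y n -> e y z -> walk_of_length e x z n.+1.
Proof.
move=> /walkP[p [xp py <-]] yz; apply/walkP; exists (rcons p z).
by rewrite rcons_path xp py yz last_rcons size_rcons.
Qed.

Lemma leq_dist x y n : walk_of_length e x y n -> dist e x y <= n.
Proof.
move=> xyn; have [Vn | nV] := leqP #|V| n.
  by apply: leq_trans Vn; rewrite -[X in _ <= X](size_iota 0) find_size.
rewrite leqNgt; apply/negP => /(before_find 0).
by rewrite nth_iota // add0n xyn.
Qed.

Lemma dist_walk x y : connect e x y -> walk_of_length e x y (dist e x y).
Proof.
case/connectP => p0 xp0 ->; case/shortenP: xp0 => p xp p_uniq _.
have p_lt : size p < #|V|.
  by have := max_card (mem (x :: p)); rewrite (card_uniqP p_uniq).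
have walk_lt : has (walk_of_length e x (last x p)) (iota 0 #|V|).
  apply/hasP; exists (size p); rewrite ?mem_iota //.
  by apply/walkP; exists p.
have := nth_find 0 walk_lt.
by rewrite nth_iota // -[X in _ < X](size_iota 0) -has_find.
Qed.

Lemma dist_xx x : dist e x x = 0.
Proof. by apply/eqP; rewrite -leqn0; apply/leq_dist/walkP; exists [::]. Qed.

Lemma dist_eq0 x y : connect e x y -> (dist e x y == 0) = (x == y).
Proof.
move=> xy; apply/eqP/eqP => [xy0 | ->]; last exact: dist_xx.
by have /walkP[[|z p] []] := dist_walk xy; rewrite xy0.
Qed.

Lemma dist_edge x y z : connect e x y -> e y z -> dist e x z <= (dist e x y).+1.
Proof. by move=> /dist_walk xy yz; apply/leq_dist/(walk_rcons xy yz). Qed.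

Lemma dist_predecessor x y : connect e x y -> x != y ->
  exists2 z, e z y & dist e x y = (dist e x z).+1.
Proof.
move=> xy neq_xy; have /walkP[p [xp py p_size]] := dist_walk xy.
case/lastP: p xp py p_size => [_ xy_eq | p z].
  by rewrite -xy_eq eqxx in neq_xy.
rewrite rcons_path last_rcons size_rcons => /andP[xp pz] zy p_size.
rewrite -zy in xy p_size *; exists (last x p) => //.
have xz : connect e x (last x p) by apply/connectP; exists p.
apply/eqP; rewrite eqn_leq dist_edge //= -p_size ltnS.
by apply/leq_dist/walkP; exists p.
Qed.

End Walks.

Section RootingATree.

Variables (V : finType) (e : rel V) (v : V).
Hypothesis e_tree : is_tree e.

Lemma tree_no_detour x a c :
  e x a -> e x c -> c \in component_without e x a -> a = c.
Proof.
case: e_tree => e_sym e_irr _ _ e_acyclic xa xc; rewrite inE.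
case/connectP => p0 ap0 p0c; case/shortenP: ap0 p0c => p ap p_uniq _ pc.
have e_ap : path e a p by apply: sub_path ap => y z /and3P[].
have x_notin : x \notin a :: p.
  rewrite inE negb_or; apply/andP; split.
    by apply: contraTneq xa => <-; rewrite e_irr.
  elim: p (a) ap {pc p_uniq e_ap} => //= z p IHp y /andP[/and3P[_ zx _] zp].
  by rewrite inE negb_or eq_sym zx (IHp z).
have := e_acyclic (x :: a :: p); rewrite /ucycle cons_uniq x_notin p_uniq andbT.
rewrite [cycle _ _]/= rcons_path xa e_ap -pc e_sym xc => /(_ isT).
by case: p pc {ap p_uniq e_ap x_notin} => //= ->.
Qed.

Lemma root_in_component_without x a :
  a != x -> level e v a <= level e v x -> v \in component_without e x a.
Proof.
case: e_tree => e_sym _ _ e_conn _.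
have [n] := ubnP (level e v a); elim: n a => // n IHn a an ax a_le_x.
rewrite inE; have [-> | va] := eqVneq a v; first exact: connect0.
rewrite eq_sym in va; have [y ya level_a] := dist_predecessor (e_conn v a) va.
rewrite -!/(level e v _) in level_a; have yx : y != x.
  by apply: contraTneq a_le_x => <-; rewrite level_a ltnn.
apply: (@connect_trans _ _ y); first by rewrite connect1 //= ax yx e_sym.
by have := IHn y; rewrite inE; apply=> //; lia.
Qed.

Lemma shallow_neighbour_unique x a c : e x a -> e x c ->
  level e v a <= level e v x -> level e v c <= level e v x -> a = c.
Proof.
case: (e_tree) => e_sym e_irr _ _ _ xa xc a_le c_le.
have neq_x z : e x z -> z != x by apply: contraTneq => ->; rewrite e_irr.
apply: (tree_no_detour xa xc); rewrite inE.
have := root_in_component_without (neq_x a xa) a_le; rewrite inE.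
have := root_in_component_without (neq_x c xc) c_le; rewrite inE => cv av.
apply: connect_trans av _; rewrite sym_connect_sym // => y z /=.
by rewrite e_sym andbCA.
Qed.

Definition tree_parent x : V :=
  odflt x [pick y | e x y && (level e v x == (level e v y).+1)].

Lemma tree_parentP x : x != v ->
  e x (tree_parent x) /\ level e v x = (level e v (tree_parent x)).+1.
Proof.
case: e_tree => e_sym _ _ e_conn _; rewrite eq_sym => vx; rewrite /tree_parent.
case: pickP => [y /andP[xy /eqP] // | no_parent].
have [y yx level_x] := dist_predecessor (e_conn v x) vx.
by have := no_parent y; rewrite e_sym yx /level level_x eqxx.
Qed.

Lemma tree_edgeE x y :
  e x y = (x != v) && (tree_parent x == y) || (y != v) && (tree_parent y == x).
Proof.
case: (e_tree) => e_sym e_irr _ e_conn _.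
have up a c : e a c -> level e v c <= level e v a ->
    (a != v) && (tree_parent a == c).
  move=> ac c_le_a; have av : a != v.
    apply: contraTneq ac => av; move: c_le_a.
    by rewrite av /level dist_xx leqn0 dist_eq0 // => /eqP <-; rewrite e_irr.
  have [ap level_a] := tree_parentP av.
  by rewrite av (shallow_neighbour_unique ap ac) //= level_a.
apply/idP/orP => [xy | [] /andP[/tree_parentP[xp _] /eqP <-] //].
  have [yx | /ltnW xy_le] := leqP (level e v y) (level e v x).
    by left; apply: up.
  by right; apply: up; rewrite // e_sym.
by rewrite e_sym.
Qed.

Definition rooted_tree_of : rooted_tree e v :=
  RootedTree (dist_xx e v) (fun x xv => (tree_parentP xv).2) tree_edgeE.

End RootingATree.

(** * Distances *)

Section Distances.

Variables (V : finType) (e : rel V) (root : V) (T : rooted_tree e root).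
Implicit Types u w x y : V.

Local Notation ancestor := (ancestor T).

(* The number of edges [u -- parent T u] on the path from [x] to [y]. *)
Definition separation x y : nat :=
  \sum_(u | u != root) (ancestor u x (+) ancestor u y).

Lemma separationC x y : separation x y = separation y x.
Proof. by apply: eq_bigr => u _; rewrite addbC. Qed.

Lemma separation_xx x : separation x x = 0.
Proof. by rewrite /separation big1 // => u _; rewrite addbb. Qed.

Lemma separation_parent x y : x != root ->
  separation x y + ancestor x y = separation (parent T x) y + ~~ ancestor x y.
Proof.
move=> xr; rewrite /separation (bigD1 x) //= [in RHS](bigD1 x) //=.
have -> : ancestor x (parent T x) = false.
  by apply/negP => /leq_ancestor; rewrite (depth_parent T xr) ltnn.
have E u : (u != root) && (u != x) ->
    ancestor u x (+) ancestor u y =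
    ancestor u (parent T x) (+) ancestor u y :> nat.
  by case/andP => _ /negPf ux; rewrite (ancestorE T u x) ux xr.
by rewrite (eq_bigr _ E) ancestor_refl; case: (ancestor x y) => /=; lia.
Qed.

Lemma separation_edge x y z : e x y -> separation x z <= (separation y z).+1.
Proof.
rewrite (edgeE T) => /orP[] /andP[r /eqP <-];
  by have := separation_parent z r; case: (ancestor _ z) => /=; lia.
Qed.

Lemma separation_walk x y n : walk_of_length e x y n -> separation x y <= n.
Proof.
case/walkP => p [xp <- <-]; elim: p x xp => [|z p IHp] x /=.
  by rewrite separation_xx.
by case/andP => /(separation_edge (last z p)) xz /IHp; lia.
Qed.

Lemma separation_eq0 x y : (separation x y == 0) = (x == y).
Proof.
apply/eqP/eqP => [|->]; last exact: separation_xx.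
move=> /eqP; rewrite sum_nat_eq0 => /forall_inP no_sep.
have same u : ancestor u x = ancestor u y.
  have [-> | /no_sep] := eqVneq u root; first by rewrite !root_ancestor.
  by case: (ancestor u x) (ancestor u y) => [] [].
apply: (ancestor_anti (T := T)); first by rewrite -same ancestor_refl.
by rewrite same ancestor_refl.
Qed.

Lemma walk_separation x y : walk_of_length e x y (separation x y).
Proof.
move sep_xy: (separation x y) => n; elim: n x y sep_xy => [|n IHn] x y sep_xy.
  apply/walkP; exists [::]; split=> //.
  by apply/eqP; rewrite -separation_eq0 sep_xy.
have xy : x != y by rewrite -separation_eq0 sep_xy.
have [anc_xy | not_anc_xy] := boolP (ancestor x y); last first.
  have xr : x != root.
    by apply: contraNneq not_anc_xy => ->; apply: root_ancestor.
  apply: (walk_cons (parent_edge T xr)); apply: IHn.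
  by have := separation_parent y xr; rewrite (negPf not_anc_xy) /=; lia.
have not_anc_yx : ~~ ancestor y x.
  by apply: contraNN xy => /(ancestor_anti anc_xy) ->.
have yr : y != root.
  by apply: contraNneq not_anc_yx => ->; apply: root_ancestor.
apply: (@walk_rcons _ _ _ (parent T y)); last first.
  by rewrite (rooted_tree_sym T) parent_edge.
apply: IHn; rewrite separationC; have := separation_parent x yr.
by rewrite separationC (negPf not_anc_yx) /=; lia.
Qed.

Lemma distE x y : dist e x y = separation x y.
Proof.
have xy := walk_separation x y; apply/eqP; rewrite eqn_leq leq_dist //=.
apply/separation_walk/dist_walk; case/walkP: xy => p [xp py _].
by apply/connectP; exists p.
Qed.

Lemma levelE x : level e root x = depth T x.
Proof.
rewrite /level distE -sum_ancestor_depth; apply: eq_bigr => u ur.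
by rewrite ancestor_root (negPf ur).
Qed.

Lemma childrenE x : children e root x = kids T x.
Proof.
apply/setP => y; rewrite !inE !levelE (edgeE T) orbC.
have [-> | yr] /= := eqVneq y root; first by rewrite depth_root andbF.
have [pyx | pyx] /= := eqVneq (parent T y) x.
  by rewrite (depth_parent T yr) pyx eqxx.
apply/negP => /andP[/andP[xr /eqP <-]].
by rewrite (depth_parent T xr); lia.
Qed.

Lemma degreeE x : degree e x = #|kids T x| + (x != root).
Proof.
have [-> | xr] /= := eqVneq x root.
  by rewrite addn0; apply: eq_card => y; rewrite !inE (edgeE T) eqxx.
have px : parent T x \notin kids T x.
  by apply/negP => /depth_kid; rewrite (depth_parent T xr); lia.
transitivity #|parent T x |: kids T x|; last by rewrite cardsU1 px addnC.
by apply: eq_card => y; rewrite !inE (edgeE T) xr (eq_sym (parent T x)).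
Qed.

Lemma leavesE : 1 < #|kids T root| -> leaves e = [set x | childless T x].
Proof.
move=> root_kids; apply/setP => x; rewrite !inE degreeE -card_kids_eq0.
have [-> | _] := eqVneq x root; first by rewrite addn0; lia.
by rewrite addn1 eqSS.
Qed.

Lemma sum_dist_kid (F : {set V}) u : u \in kids T root ->
  \sum_(w in F) dist e u w + 2 * #|F :&: descendants T u| =
  \sum_(w in F) dist e root w + #|F|.
Proof.
case/kidP => ur pu; rewrite -sum_ancestor -sum1_card big_distrr -!big_split /=.
apply: eq_bigr => w _; rewrite !distE.
by have := separation_parent w ur; rewrite pu; case: (ancestor u w) => /=; lia.
Qed.

End Distances.

Lemma sum_unordered_pairs (I : finType) (A : {set I}) (F : I -> I -> nat) :
  (forall x y, F x y = F y x) -> (forall x, F x x = 0) ->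
  \sum_(x in A) \sum_(y in A) F x y =
  2 * \sum_(x in A) \sum_(y in A | enum_rank x < enum_rank y) F x y.
Proof.
move=> FC F0; rewrite mul2n -addnn.
have swap : \sum_(x in A) \sum_(y in A | enum_rank x < enum_rank y) F x y =
            \sum_(y in A) \sum_(x in A | enum_rank x < enum_rank y) F x y.
  rewrite (exchange_big_dep (fun y => y \in A)) /= => [|x y _ /andP[] //].
  by apply: eq_bigr => y yA; apply: eq_bigl => x; rewrite yA.
rewrite [X in X + _]swap -big_split; apply: eq_bigr => x _ /=.
rewrite (bigID (fun y => enum_rank y < enum_rank x)) /=; congr (_ + _).
  by apply: eq_bigr => y _; apply: FC.
rewrite (bigID (pred1 x)) /= big1 ?add0n => [|y /andP[_ /eqP ->] //].
apply: eq_bigl => y; rewrite -andbA; congr (_ && _).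
rewrite -leqNgt ltn_neqAle andbC (inj_eq val_inj) (inj_eq enum_rank_inj).
by rewrite eq_sym.
Qed.

Lemma sum_crossing_pairs (I : finType) (P : pred I) (a : pred I) :
  \sum_(x | P x) \sum_(y | P y) (a x (+) a y) =
  2 * ((\sum_(x | P x) a x) * (\sum_(x | P x) 1 - \sum_(x | P x) a x)).
Proof.
set n := \sum_(x | P x) a x; set N := \sum_(x | P x) 1.
have not_a : \sum_(x | P x) ~~ a x = N - n.
  rewrite /N /n -sumnB; last by move=> x _; case: (a x).
  by apply: eq_bigr => x _; case: (a x).
transitivity (\sum_(x | P x) (a x * (N - n) + ~~ a x * n)).
  apply: eq_bigr => x _; case: (a x); last by rewrite mul0n mul1n.
  by rewrite mul0n mul1n addn0 -not_a.
by rewrite big_split /= -!big_distrl /= not_a mulnC addnn mul2n.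
Qed.

(* The edge [u -- parent T u] separates the leaves below [u] from the others. *)
Lemma sigma_LLE (V : finType) (e : rel V) (root : V) (T : rooted_tree e root) :
  1 < #|kids T root| ->
  sigma_LL e =
  \sum_(u | u != root) leaf_count T u * (leaf_count T root - leaf_count T u).
Proof.
move=> root_kids; apply/eqP; rewrite -(eqn_pmul2l (isT : 0 < 2)); apply/eqP.
rewrite -sum_unordered_pairs => [|x y|x]; last 2 first.
- by rewrite !(distE T) separationC.
- by rewrite (distE T) separation_xx.
rewrite (leavesE root_kids) big_distrr /=.
under eq_bigr => x _ do under eq_bigr => y _ do rewrite (distE T).
under eq_bigr => x _ do rewrite exchange_big.
rewrite exchange_big; apply: eq_bigr => u _ /=.
rewrite sum_crossing_pairs; congr (2 * (_ * (_ - _))).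
- by apply: eq_bigl => x; rewrite inE.
- by rewrite sum1_card leaf_count_root.
- by apply: eq_bigl => x; rewrite inE.
Qed.

(** * Crowns and Kraft's inequality *)

Section Crowns.

Variables (V : finType) (e : rel V) (root : V) (T : rooted_tree e root).
Implicit Types (B : {set V}) (u w x y : V).

Local Notation ancestor := (ancestor T).
Local Notation kids := (kids T).
Local Notation childless := (childless T).
Local Notation leaf_count := (leaf_count T).

Definition crown B : Prop :=
  [/\ root \in B, (forall x, x \in B -> x != root -> parent T x \in B)
    & (forall x, x \in B -> ~~ childless x)].

(* For a crown [B]: the depth in the forest of the nodes outside [B], whose
   roots have depth 1. *)
Definition depth_outside B w : nat := \sum_(u | u \notin B) ancestor u w.

Definition path_length_outside B : nat := \sum_(u | u \notin B) leaf_count u.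

Lemma depth_outside_parent B w : w != root ->
  depth_outside B w = (w \notin B) + depth_outside B (parent T w).
Proof.
move=> wr; rewrite /depth_outside.
under eq_bigr => u _ do rewrite ancestor_count //.
rewrite big_split /=; congr (_ + _).
have [wB | wB] := boolP (w \in B).
  by rewrite big1 // => u uB; case: eqP uB => // ->; rewrite wB.
by rewrite (bigD1 w) //= eqxx big1 // => u /andP[_ /negPf ->].
Qed.

Lemma leq_depth_outside B u w :
  ancestor u w -> depth_outside B u <= depth_outside B w.
Proof.
move=> uw; apply: leq_sum => x _.
by case: (boolP (ancestor x u)) => // /ancestor_trans/(_ uw) ->.
Qed.

Lemma depth_outside_below B u :
  (forall x, ancestor u x -> x != u -> x \notin B) ->
  forall x, ancestor u x ->
    depth_outside B x = depth_outside B u + (depth T x - depth T u).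
Proof.
move=> out_below x; elim/(rooted_ind T): x => [| x xr IHx].
  by rewrite ancestor_root => /eqP ->; rewrite subnn addn0.
have [<- _ | ux anc_ux] := eqVneq u x; first by rewrite subnn addn0.
have anc_up := ancestor_parent anc_ux ux.
rewrite depth_outside_parent // out_below // 1?eq_sym // IHx //.
by rewrite (depth_parent T xr) subSn ?leq_ancestor // addnCA.
Qed.

Lemma path_length_outsideE B :
  path_length_outside B = \sum_(x | childless x) depth_outside B x.
Proof. exact: exchange_big. Qed.

Section Crown.

Variable B : {set V}.
Hypothesis B_crown : crown B.

Lemma crown_root : root \in B.
Proof. by case: B_crown. Qed.

Lemma crown_parent w : w \in B -> w != root -> parent T w \in B.
Proof. by case: B_crown => _ + _; apply. Qed.

Lemma crown_childless x : childless x -> x \notin B.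
Proof. by case: B_crown => _ _ internal; apply: contraL => /internal. Qed.

Lemma outside_neq_root x : x \notin B -> x != root.
Proof. by apply: contraNneq => ->; apply: crown_root. Qed.

Lemma depth_outside_crown w : w \in B -> depth_outside B w = 0.
Proof.
elim/(rooted_ind T): w => [| w wr IHw] wB.
  rewrite /depth_outside big1 // => u /outside_neq_root /negPf.
  by rewrite ancestor_root => ->.
by rewrite depth_outside_parent // wB IHw // crown_parent.
Qed.

Lemma depth_outside_kid x w :
  w \in kids x -> w \notin B -> depth_outside B w = (depth_outside B x).+1.
Proof. by case/kidP => wr <- wB; rewrite depth_outside_parent // wB. Qed.

Lemma depth_outside_gt0 x : x \notin B -> 0 < depth_outside B x.
Proof.
by move=> xB; rewrite depth_outside_parent ?outside_neq_root // xB.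
Qed.

Lemma leaf_count_le_path_length_outside :
  leaf_count root <= path_length_outside B.
Proof.
rewrite path_length_outsideE leaf_count_root -sum1dep_card.
by apply: leq_sum => x /crown_childless; apply: depth_outside_gt0.
Qed.

Lemma sum_depth_outside (F : nat -> nat) :
  \sum_(w | w \notin B) F (depth_outside B w) + #|B|.-1 * F 1 =
  \sum_x #|kids x| * F (depth_outside B x).+1.
Proof.
rewrite -(sum_parent T (fun x => F (depth_outside B x).+1)).
rewrite [RHS](bigID (mem B)) /= addnC; congr (_ + _).
  rewrite (eq_bigr (fun=> F 1)) => [|w /andP[wr wB]]; last first.
    by rewrite depth_outside_crown // crown_parent.
  rewrite sum_nat_cond_const (cardD1 root) crown_root /=; congr (_ * _).
  by apply: eq_card => w; rewrite !inE.
apply: eq_big => [w | w wB].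
  by case: (boolP (w \in B)) => wB; rewrite ?andbF // outside_neq_root.
by rewrite depth_outside_parent ?outside_neq_root // wB.
Qed.

End Crown.

End Crowns.

Lemma bernoulli b n : 0 < b -> 1 + b.-1 * n <= b ^ n.
Proof.
move=> b_gt0; elim: n => [|n IHn]; first by rewrite muln0.
rewrite expnS; apply: leq_trans (leq_mul (leqnn b) IHn).
by case: b b_gt0 {IHn} => // c _; rewrite /=; nia.
Qed.

Section Kraft.

Variable b : nat.
Hypothesis b_gt1 : 1 < b.

Lemma bernoulli_strict n : 1 < n -> 1 + b.-1 * n.+1 <= b ^ n.
Proof.
case: n => [// | n] n_gt0; rewrite expnS.
apply: leq_trans (leq_mul (leqnn b) (bernoulli n (ltnW b_gt1))).
by case: b b_gt1 => [|[|c]] //= _; nia.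
Qed.

(* The weights [b ^ (k.+1 - d)] of Kraft's inequality, rounded down to 0 beyond
   depth [k.+1]. *)
Definition kraft_weight k d : nat := if d <= k.+1 then b ^ (k.+1 - d) else 0.

Lemma kraft_weightS k d : b * kraft_weight k d.+1 <= kraft_weight k d.
Proof.
rewrite /kraft_weight; case: (ltnP d k.+1) => dk; last by rewrite muln0.
by rewrite (ltnW dk) -expnS subnSK.
Qed.

Lemma kraft_weight1 k : kraft_weight k 1 = b ^ k.
Proof. by rewrite /kraft_weight subn1. Qed.

Lemma kraft_weight_tangent k d :
  1 + b.-1 * k.+1 <= kraft_weight k d + b.-1 * d.
Proof.
rewrite /kraft_weight; case: (leqP d k.+1) => dk.
  by rewrite -{1}(subnK dk) mulnDr addnA leq_add2r bernoulli // ltnW.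
by have := leq_mul (leqnn b.-1) dk; rewrite mulnS; lia.
Qed.

End Kraft.

Section Slack.

Variables (V : finType) (e : rel V) (root : V) (T : rooted_tree e root).
Variable b : nat.
Hypothesis b_gt1 : 1 < b.
Implicit Types (B : {set V}) (x : V).

Local Notation kids := (kids T).
Local Notation childless := (childless T).

Definition arity_le : Prop := forall x, #|kids x| <= b + (x == root).

(* How far a node is from equality in [kraft_weight_tangent], if childless, and
   in Kraft's inequality otherwise; [slackE] shows that the subtractions do not
   truncate. *)
Definition slack B k x : nat :=
  let d := depth_outside T B x in
  if childless x then kraft_weight b k d + b.-1 * d - (1 + b.-1 * k.+1)
  else (if x \in B then (b + (x == root)) * b ^ k else kraft_weight b k d)
       - #|kids x| * kraft_weight b k d.+1.

Definition total_slack B k : nat := \sum_x slack B k x.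

(* By [kraft_identity], [path_length_outside T B] is then the least integer that
   a nonnegative slack allows. *)
Definition tight B k : Prop := total_slack B k <= b - 2.

Hypothesis T_arity : arity_le.

Lemma arity_le_outside B x : crown T B -> x \notin B -> #|kids x| <= b.
Proof.
move=> B_crown /(outside_neq_root B_crown)/negPf xr.
by have := T_arity x; rewrite xr addn0.
Qed.

Section Crown.

Variable B : {set V}.
Hypothesis B_crown : crown T B.

Local Notation depth_outside := (depth_outside T B).

Lemma slackE k x :
  slack B k x + #|kids x| * kraft_weight b k (depth_outside x).+1 +
    childless x * (1 + b.-1 * k.+1) =
  (if x \in B then (b + (x == root)) * b ^ k
   else kraft_weight b k (depth_outside x)) +
    childless x * (b.-1 * depth_outside x).
Proof.
rewrite /slack; have [x0 | x0] := boolP (childless x).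
  rewrite (negPf (crown_childless B_crown x0)) (eqP x0) cards0 addn0 !mul1n.
  by rewrite subnK // kraft_weight_tangent.
rewrite !addn0 subnK //; case: ifP => [xB | /negbT xB].
  by rewrite depth_outside_crown // kraft_weight1 leq_mul2r T_arity orbT.
apply: leq_trans (kraft_weightS _ _ _).
by rewrite leq_mul2r (arity_le_outside B_crown) ?orbT.
Qed.

Lemma total_slackE k :
  total_slack B k + \sum_x #|kids x| * kraft_weight b k (depth_outside x).+1 +
    leaf_count T root * (1 + b.-1 * k.+1) =
  (#|B| * b + 1) * b ^ k +
    \sum_(x | x \notin B) kraft_weight b k (depth_outside x) +
    b.-1 * path_length_outside T B.
Proof.
have leavesE : leaf_count T root * (1 + b.-1 * k.+1) =
    \sum_x childless x * (1 + b.-1 * k.+1).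
  by rewrite -big_distrl leaf_count_root -sum1dep_card [in LHS]big_mkcond.
have pathE : b.-1 * path_length_outside T B =
    \sum_x childless x * (b.-1 * depth_outside x).
  rewrite path_length_outsideE big_distrr [LHS]big_mkcond.
  by apply: eq_bigr => x _; case: (childless x); rewrite ?mul1n.
have crownE : (#|B| * b + 1) * b ^ k =
    \sum_(x in B) (b + (x == root)) * b ^ k.
  rewrite -big_distrl big_split /= sum_nat_const.
  rewrite (bigD1 root) ?(crown_root B_crown) //= eqxx.
  by rewrite big1 // => x /andP[_ /negPf ->].
rewrite leavesE pathE crownE -!big_split (eq_bigr _ (fun x _ => slackE k x)).
rewrite big_split /=; congr (_ + _); rewrite (bigID (mem B)) /=.
by congr (_ + _); apply: eq_bigr => x; [move-> | move/negPf->].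
Qed.

Lemma kraft_identity k :
  b.-1 * path_length_outside T B + (#|B| * b.-1 + 2) * b ^ k =
  (b.-1 * k + b) * leaf_count T root + total_slack B k.
Proof.
have := total_slackE k; rewrite -(sum_depth_outside B_crown) kraft_weight1.
have [c ->] : exists c, b = c.+1 by exists b.-1; lia.
have [d ->] : exists d, #|B| = d.+1.
  by exists #|B|.-1; rewrite prednK // (cardD1 root) (crown_root B_crown).
by rewrite /=; nia.
Qed.

End Crown.

Section Tight.

Variables (B : {set V}) (k : nat).
Hypotheses (B_crown : crown T B) (B_tight : tight B k).

Local Notation depth_outside := (depth_outside T B).

Lemma slack_tight x : slack B k x <= b - 2.
Proof.
by apply: leq_trans B_tight; rewrite /total_slack (bigD1 x) //= leq_addr.
Qed.

Lemma slack_tight_pair x y : x != y -> slack B k x + slack B k y <= b - 2.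
Proof.
move=> xy; apply: leq_trans B_tight; rewrite /total_slack (bigD1 x) //=.
by rewrite leq_add2l (bigD1 y) 1?eq_sym //= leq_addr.
Qed.

Lemma tight_leaf_depth_ge x : childless x -> k <= depth_outside x.
Proof.
move=> x0; have := slack_tight x; rewrite /slack x0.
have [// | lt_dk] := leqP k (depth_outside x).
have d_le : depth_outside x <= k.+1 by rewrite leqW // ltnW.
have /(bernoulli_strict b_gt1) : 1 < k.+1 - depth_outside x by lia.
rewrite /kraft_weight d_le -{4}(subnK d_le) mulnDr mulnS; lia.
Qed.

(* The parent of a deeper leaf would have positive slack as well. *)
Lemma tight_leaf_depth_le x : childless x -> depth_outside x <= k.+1.
Proof.
move=> x0; have xB := crown_childless B_crown x0.
have xr := outside_neq_root B_crown xB.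
have := slack_tight_pair (parent_neq T xr); rewrite /slack x0.
rewrite (negPf (kid_internal (kid_of_parent T xr))).
rewrite (depth_outside_parent T B xr) xB add1n.
set d := depth_outside (parent T x); rewrite /kraft_weight.
have [// | lt_kd] := leqP d.+1 k.+1.
have -> : parent T x \in B = false.
  by apply: contraTF lt_kd => /(depth_outside_crown B_crown); rewrite /d => ->.
have d_ge := leq_mul (leqnn b.-1) lt_kd; rewrite muln0 subn0 add0n mulnS.
have [d_le | lt_kd'] := leqP d k.+1.
  by have : 0 < b ^ (k.+1 - d) by [rewrite expn_gt0; lia]; lia.
by have := leq_mul (leqnn b.-1) lt_kd'; rewrite !mulnS in d_ge *; lia.
Qed.

Lemma tight_internal_depth x :
  x \notin B -> ~~ childless x -> depth_outside x <= k.
Proof.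
move=> xB /set0Pn[w wx]; have [y wy y0] := childless_descendant T w.
have := leq_trans (leq_depth_outside B wy) (tight_leaf_depth_le y0).
rewrite (depth_outside_kid wx) //; apply: contraNN xB => wB.
by case/kidP: wx => wr <-; apply: crown_parent.
Qed.

Lemma slack_internal x : x \notin B -> ~~ childless x ->
  slack B k x = (b - #|kids x|) * b ^ (k - depth_outside x).
Proof.
move=> xB x0; have d_le := tight_internal_depth xB x0.
rewrite /slack (negPf x0) (negPf xB) /kraft_weight ltnS d_le ltnW //.
by rewrite subSS subSn // expnS mulnBl.
Qed.

Lemma tight_arity_ge2 x : x \notin B -> ~~ childless x -> 1 < #|kids x|.
Proof.
move=> xB x0; have := slack_tight x; rewrite slack_internal //.
have := leq_pmulr (b - #|kids x|) (_ : 0 < b ^ (k - depth_outside x)).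
rewrite expn_gt0; lia.
Qed.

Lemma tight_arity_full x :
  x \notin B -> ~~ childless x -> depth_outside x < k -> #|kids x| = b.
Proof.
move=> xB x0 lt_dk; apply/eqP; rewrite eqn_leq (arity_le_outside B_crown) //=.
rewrite -subn_eq0; have := slack_tight x; rewrite slack_internal //.
case: (b - #|kids x|) => // n; have : b ^ 1 <= b ^ (k - depth_outside x).
  by rewrite leq_exp2l // subn_gt0.
by rewrite expn1 mulSn; lia.
Qed.

Lemma tight_arity_crown x : x \in B -> 0 < k -> #|kids x| = b + (x == root).
Proof.
move=> xB k_gt0; apply/eqP; rewrite eqn_leq T_arity /= -subn_eq0.
have := slack_tight x; rewrite /slack xB depth_outside_crown // kraft_weight1.
have /negPf -> : ~~ childless x by case: B_crown => _ _; apply.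
rewrite -mulnBl; case: (b + (x == root) - #|kids x|) => // n.
have : b ^ 1 <= b ^ k by rewrite leq_exp2l.
by rewrite expn1 mulSn; lia.
Qed.

End Tight.

End Slack.

(** * Heaps *)

Record frugal (b i L : nat) (V : finType) (e : rel V) (root : V)
    (T : rooted_tree e root) : Prop := Frugal {
  frugal_arity : arity_le T b;
  frugal_root_kids : 1 < #|kids T root|;
  frugal_leaf_count : leaf_count T root = L;
  frugal_card : #|V| = L + i;
  frugal_crown : forall j, j < i ->
    exists B k, [/\ crown T B, #|B| = j.+1 & tight T b B k] }.

Lemma card_ord_interval m lo hi :
  #|[set q : 'I_m | lo <= q < hi]| = minn hi m - minn lo m.
Proof.
rewrite -sum1dep_card big_mkcond /=.
elim: m => [|m IHm]; first by rewrite big_ord0; lia.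
by rewrite big_ord_recr /= IHm; case: ifP; lia.
Qed.

Section Heap.

Variables b i L : nat.
Hypotheses (b_gt1 : 1 < b) (i_gt0 : 0 < i) (b_lt_L : b < L).
Hypotheses (L_ge : i.-1 * b.-1 + 3 <= L) (L_le : L <= i * b.-1 + 2).

Let N := (L + i).-1.
Local Notation node := 'I_N.+1.
Implicit Types p q : node.

(* Breadth-first numbering: the children of [0] are [1 .. b.+1], and those of
   [n > 0] are [n * b + 2 .. n * b + b.+1]; [1 - 2 = 0] gives [1] its parent
   [0]. *)
Definition heap_parent (n : nat) : nat := (n - 2) %/ b.

Lemma heap_parent_lt n : 0 < n -> heap_parent n < n.
Proof.
case: n => // n _; apply: leq_ltn_trans (leq_div _ _) _.
by rewrite ltnS subSS leq_subr.
Qed.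

Lemma leq_heap_parent m n : m <= n -> heap_parent m <= heap_parent n.
Proof. by move=> mn; apply/leq_div2r/leq_sub2r. Qed.

Lemma heap_parent_iter n : exists k, iter k heap_parent n == 0.
Proof.
elim/ltn_ind: n => -[|n] IHn; first by exists 0.
have [k nk] := IHn _ (heap_parent_lt (ltn0Sn n)).
by exists k.+1; rewrite iterSr.
Qed.

Definition heap_depth n : nat := ex_minn (heap_parent_iter n).

Lemma heap_depth0 : heap_depth 0 = 0.
Proof. by rewrite /heap_depth; case: ex_minnP => k _ /(_ 0 isT); case: k. Qed.

Lemma heap_depth_parent n :
  0 < n -> heap_depth n = (heap_depth (heap_parent n)).+1.
Proof.
rewrite /heap_depth => n_gt0; case: ex_minnP => -[|k]; first by rewrite gtn_eqF.
rewrite iterSr => nk k_min; case: ex_minnP => m nm m_min.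
apply/eqP; rewrite eqSS eqn_leq m_min // andbT -ltnS.
by apply: k_min; rewrite iterSr.
Qed.

Definition heap_up p : node := inord (heap_parent p).

Lemma val_heap_up p : heap_up p = heap_parent p :> nat.
Proof.
rewrite inordK //; apply: leq_ltn_trans (ltn_ord p).
by apply: leq_trans (leq_div _ _) (leq_subr _ _).
Qed.

Definition heap_edge : rel node :=
  fun p q => (p != ord0) && (heap_up p == q) || (q != ord0) && (heap_up q == p).

Lemma heap_depth_up p : p != ord0 -> heap_depth p = (heap_depth (heap_up p)).+1.
Proof. by move=> p0; rewrite val_heap_up heap_depth_parent // lt0n. Qed.

Definition heap : rooted_tree heap_edge ord0 :=
  RootedTree heap_depth0 heap_depth_up (fun p q => erefl (heap_edge p q)).

Lemma card_heap_kids p :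
  #|kids heap p| = minn (p * b + b + 2) N.+1 - minn (p * b + 1 + (0 < p)) N.+1.
Proof.
rewrite -card_ord_interval; apply: eq_card => q.
rewrite !inE -!val_eqE /= val_heap_up.
have -> : (heap_parent q == p) = (q - 2 < p * b + b) && (p * b <= q - 2).
  have b_gt0 : 0 < b by lia.
  by rewrite eqn_leq -ltnS ltn_divLR // leq_divRL // mulSn addnC.
case: (posnP p) => p0; first by rewrite p0 mul0n; lia.
have : 0 < p * b by rewrite muln_gt0 p0; lia.
lia.
Qed.

Let N_ge : i.-1 * b + 3 <= N.+1.
Proof.
have : i.-1 * b = i.-1 * b.-1 + i.-1 by rewrite -mulnSr prednK; lia.
rewrite /N; lia.
Qed.

Let N_le : N.+1 <= i * b + 2.
Proof.
have : i * b = i * b.-1 + i by rewrite -mulnSr prednK; lia.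
rewrite /N; lia.
Qed.

Lemma heap_kids_full p : p < i.-1 -> #|kids heap p| = b + (p == ord0).
Proof.
move=> pi; rewrite card_heap_kids -val_eqE /=.
have : p.+1 * b <= i.-1 * b by rewrite leq_mul2r pi orbT.
by rewrite mulSn; have := N_ge; case: (posnP p) => [-> | _] /=; lia.
Qed.

Lemma heap_kids_last p : p = i.-1 :> nat ->
  1 < #|kids heap p| <= b + (p == ord0) /\ (p = ord0 -> #|kids heap p| = b.+1).
Proof.
move=> pi; rewrite card_heap_kids -val_eqE /= pi.
have ib : i * b = i.-1 * b + b by rewrite -{1}(prednK i_gt0) mulSn addnC.
split; first by have := N_ge; have := N_le; lia.
by move/(congr1 val); rewrite /= pi => i1; rewrite i1 mul0n; lia.
Qed.

Lemma heap_kids_none p : i <= p -> #|kids heap p| = 0.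
Proof.
move=> ip; rewrite card_heap_kids.
have : i * b <= p * b by rewrite leq_mul2r ip orbT.
by have := N_le; lia.
Qed.

Lemma childless_heap p : childless heap p = (i <= p).
Proof.
rewrite -card_kids_eq0; case: (leqP i p) => [/heap_kids_none -> // | pi].
case: (ltnP p i.-1) => [/heap_kids_full -> | ip]; first lia.
have [|] := @heap_kids_last p; lia.
Qed.

Lemma heap_arity : arity_le heap b.
Proof.
move=> p; case: (leqP i p) => [/heap_kids_none -> // | pi].
case: (ltnP p i.-1) => [/heap_kids_full -> // | ip].
by have [|/andP[_ kids_le] _ //] := @heap_kids_last p; lia.
Qed.

Lemma heap_leaf_count : leaf_count heap ord0 = L.
Proof.
rewrite leaf_count_root.
transitivity #|[set p : node | i <= p < N.+1]|.
  by apply: eq_card => p; rewrite !inE childless_heap ltn_ord andbT.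
by rewrite card_ord_interval /N; lia.
Qed.

Section HeapCrown.

Variable j : nat.
Hypothesis j_lt_i : j < i.

Definition heap_crown : {set node} := [set p : node | p <= j].

Local Notation d := (depth_outside heap heap_crown).

Lemma heap_crownP : crown heap heap_crown.
Proof.
split=> [|p|p]; rewrite !inE //; last by rewrite childless_heap; lia.
move=> pj p0; rewrite val_heap_up; have := @heap_parent_lt p.
by rewrite lt0n => /(_ p0); lia.
Qed.

Lemma card_heap_crown : #|heap_crown| = j.+1.
Proof.
transitivity #|[set p : node | 0 <= p < j.+1]|; last first.
  by rewrite card_ord_interval /N; lia.
by apply: eq_card => p; rewrite !inE.
Qed.

Lemma leq_heap_depth_outside p q : p <= q -> d p <= d q.
Proof.
elim/(rooted_ind heap): q p => [|q q0 IHq] p pq.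
  by have -> : p = ord0 by apply: val_inj; move: pq; rewrite leqn0 => /eqP.
have [-> | p0] := eqVneq p ord0.
  by rewrite (depth_outside_crown heap_crownP) // inE.
rewrite (depth_outside_parent heap _ p0) (depth_outside_parent heap _ q0).
apply: leq_add.
  by rewrite !inE -!ltnNge; case: (ltnP j p) => // /leq_trans/(_ pq) ->.
by apply: IHq; rewrite !val_heap_up leq_heap_parent.
Qed.

Let last_internal : node := heap_up ord_max.

Let val_last_internal : last_internal = i.-1 :> nat.
Proof.
rewrite val_heap_up /heap_parent; apply/eqP; rewrite eqn_leq.
by rewrite -ltnS prednK // ltn_divLR ?leq_divRL /=; lia.
Qed.

Local Notation k := (d last_internal).

Lemma heap_depth_outside_le p : d p <= k.+1.
Proof.
have max0 : ord_max != ord0 :> node by rewrite -val_eqE /= /N; lia.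
have max_out : (ord_max : node) \notin heap_crown by rewrite inE /= /N; lia.
have := depth_outside_parent heap heap_crown max0; rewrite max_out add1n => <-.
by apply: leq_heap_depth_outside; rewrite -ltnS.
Qed.

Lemma heap_slack_childless p : i <= p -> slack heap b heap_crown k p = 0.
Proof.
move=> ip; rewrite /slack childless_heap ip /kraft_weight heap_depth_outside_le.
have : k <= d p.
  by apply: leq_heap_depth_outside; rewrite val_last_internal; lia.
have := heap_depth_outside_le p.
rewrite leq_eqVlt ltnS => /orP[/eqP -> _ | dk kd].
  by rewrite subnn expn0; lia.
have -> : d p = k by apply/eqP; rewrite eqn_leq dk.
by rewrite subSn // subnn expn1 mulnS; lia.
Qed.

Lemma heap_slack_internal p : p < i -> slack heap b heap_crown k p =
  (b + (p == ord0) - #|kids heap p|) * b ^ (k - d p).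
Proof.
move=> pi; rewrite /slack childless_heap leqNgt pi /=.
have dk : d p <= k.
  by apply: leq_heap_depth_outside; rewrite val_last_internal; lia.
case: ifP => pB.
  by rewrite (depth_outside_crown heap_crownP pB) kraft_weight1 subn0 mulnBl.
have /negPf -> : p != ord0 by apply: contraFneq pB => ->; rewrite inE.
by rewrite addn0 /kraft_weight ltnS dk leqW // subSS subSn // expnS mulnBl.
Qed.

Lemma heap_crown_tight : tight heap b heap_crown k.
Proof.
rewrite /tight /total_slack (bigD1 last_internal) //= big1 => [|p p_last].
  rewrite addn0 heap_slack_internal ?val_last_internal; last by rewrite prednK.
  have [/andP[kids_gt1 kids_le] root_kids] := heap_kids_last val_last_internal.
  rewrite subnn expn0 muln1; case: eqP => [/root_kids | _]; lia.
have [/heap_slack_childless // | pi] := leqP i p.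
rewrite heap_slack_internal // heap_kids_full ?subnn //.
by move: p_last; rewrite -val_eqE /= val_last_internal; lia.
Qed.

End HeapCrown.

Lemma heap_frugal : frugal b i L heap.
Proof.
split; [exact: heap_arity | | exact: heap_leaf_count | | ].
- case: (posnP i.-1) => i1; last by rewrite heap_kids_full //; lia.
  by have [|_ -> //] := @heap_kids_last ord0; last lia.
- by rewrite card_ord /N; lia.
move=> j ji; exists (heap_crown j); eexists.
split; [exact: heap_crownP | exact: card_heap_crown | exact: heap_crown_tight].
Qed.

End Heap.

(** * Comparison with a heap *)

Lemma sum_half_succ x : \sum_(t < x.*2.+1) t./2.+1 = x.+1 * x.+1.
Proof.
elim: x => [|x IHx]; first by rewrite big_ord1.
by rewrite doubleS !(big_ord_recr _.+1) IHx /= uphalf_double doubleK; lia.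
Qed.

Lemma sum_minn_half x L :
  x.*2 <= L -> \sum_(t < L.-1) minn x t./2.+1 = x * (L - x).
Proof.
elim: L => [|L IHL]; first by case: x => //; rewrite big_ord0.
rewrite leq_eqVlt => /orP[/eqP xL | xL].
  rewrite -xL -[in RHS]addnn addnK; case: x {xL IHL} => [|x].
    by rewrite big_ord0.
  rewrite doubleS -sum_half_succ; apply: eq_bigr => t _.
  by apply/minn_idPr; have := ltn_ord t; rewrite -[t : nat]odd_double_half; lia.
case: L => [|L] in IHL xL *; first by case: x xL {IHL} => //; rewrite big_ord0.
rewrite big_ord_recr /= [X in X + _]IHL ?(minn_idPl _) //; first by nia.
by rewrite -[L]odd_double_half in xL; lia.
Qed.

Lemma leq_sum_minn_half x L :
  x <= L -> x * (L - x) <= \sum_(t < L.-1) minn x t./2.+1.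
Proof.
move=> xL; have [/sum_minn_half -> // | Lx] := leqP x.*2 L.
have half2_le : L./2.*2 <= L by rewrite -[X in _ <= X]odd_double_half leq_addl.
have half2_ge : L <= L./2.*2.+1 by rewrite -[X in X <= _]odd_double_half; lia.
apply: (@leq_trans (L./2 * (L - L./2))); first by nia.
rewrite -sum_minn_half //; apply: leq_sum => t _; lia.
Qed.

Section ClippedLeafCount.

Variables (V : finType) (e : rel V) (root : V) (T : rooted_tree e root).
Implicit Types (B F : {set V}) (u : V) (t : nat).

Local Notation leaf_count := (leaf_count T).

Definition clipped_leaf_count t : nat :=
  \sum_(u | u != root) minn (leaf_count u) t.

Lemma sum_clipped_leaf_count L :
  \sum_(t < L.-1) clipped_leaf_count t./2.+1 =
  \sum_(u | u != root) \sum_(t < L.-1) minn (leaf_count u) t./2.+1.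
Proof. exact: exchange_big. Qed.

Lemma sigma_LL_le_clipped : 1 < #|kids T root| ->
  sigma_LL e <=
  \sum_(t < (leaf_count root).-1) clipped_leaf_count t./2.+1.
Proof.
move=> root_kids; rewrite (sigma_LLE root_kids) sum_clipped_leaf_count.
by apply: leq_sum => u _; rewrite leq_sum_minn_half // leaf_count_le_root.
Qed.

Definition leaf_balanced : Prop :=
  forall u, u != root -> 2 * leaf_count u <= leaf_count root.

Lemma sigma_LL_clipped : 1 < #|kids T root| -> leaf_balanced ->
  sigma_LL e = \sum_(t < (leaf_count root).-1) clipped_leaf_count t./2.+1.
Proof.
move=> root_kids half; rewrite (sigma_LLE root_kids) sum_clipped_leaf_count.
by apply: eq_bigr => u /half; rewrite mul2n => /sum_minn_half.
Qed.

Lemma clipped_leaf_count1 : (clipped_leaf_count 1).+1 = #|V|.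
Proof.
rewrite /clipped_leaf_count (eq_bigr (fun=> 1)) => [|u _]; last first.
  exact/minn_idPr/leaf_count_gt0.
by rewrite sum1_card (cardC1 root) prednK //; apply/card_gt0P; exists root.
Qed.

Definition separates t B : bool :=
  [forall (u | u != root),
     if u \in B then t <= leaf_count u else leaf_count u <= t].

Lemma clipped_leaf_count_le t B : root \in B ->
  clipped_leaf_count t <= t * #|B|.-1 + path_length_outside T B
    ?= iff separates t B.
Proof.
move=> rB.
have -> : t * #|B|.-1 + path_length_outside T B =
    \sum_(u | u != root) (if u \in B then t else leaf_count u).
  rewrite [RHS](bigID (mem B)) /=; congr (_ + _).
    rewrite (eq_bigr (fun=> t)) => [|u /andP[_ ->] //].
    rewrite sum_nat_cond_const mulnC (cardD1 root) rB; congr (_ * _).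
    by apply: eq_card => u; rewrite !inE.
  apply: eq_big => [u | u /negPf -> //].
  case: (boolP (u \in B)) => uB; rewrite ?andbF // andbT.
  by apply/esym; apply: contraNneq uB => ->.
by apply: leqif_sum => u _; case: ifP => _; split; lia.
Qed.

Definition heavy t : {set V} := [set u | (u == root) || (t < leaf_count u)].

Lemma heavy_separates t : separates t (heavy t).
Proof.
apply/forall_inP => u /negPf ur; rewrite inE ur /=.
by case: leqP => // /ltnW.
Qed.

Lemma heavy_crown t : 0 < t -> ~~ childless T root -> crown T (heavy t).
Proof.
move=> t_gt0 root_internal; split; rewrite ?inE ?eqxx // => x; rewrite !inE.
  case/orP => [-> // | tx xr]; apply/orP; right; apply: leq_trans tx _.
  exact/leq_leaf_count/ancestor_kid/kid_of_parent.
case/orP => [/eqP -> // | tx]; apply/negP => /(leaf_count_childless (T := T)).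
by lia.
Qed.

Definition balanced F : Prop :=
  forall u, u != root -> 2 * #|F :&: descendants T u| <= #|F|.

Lemma balanced_root_kids_gt1 F : 2 < #|F| -> balanced F -> 1 < #|kids T root|.
Proof.
move=> F_gt2 F_balanced; have Fr : 1 < #|F :\ root|.
  by rewrite (cardsD1 root F) in F_gt2; lia.
have /card_gt0P[w] := ltnW Fr; rewrite !inE => /andP[wr _].
have [u uk _] := ancestor_kid_root T wr; rewrite ltnNge; apply/negP => kids_le1.
have kidsE : kids T root = [set u].
  by apply/esym/eqP; rewrite eqEcard sub1set uk cards1.
have F_sub : F :\ root \subset F :&: descendants T u.
  apply/subsetP => y; rewrite !inE => /andP[yr ->].
  by have [u'] := ancestor_kid_root T yr; rewrite kidsE inE => /eqP ->.
have /F_balanced : u != root by case/kidP: uk.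
by have := subset_leq_card F_sub; have := cardsD1 root F; lia.
Qed.

Lemma balanced_from_kids F :
  (forall u, u \in kids T root -> 2 * #|F :&: descendants T u| <= #|F|) ->
  balanced F.
Proof.
move=> kids_half w /(ancestor_kid_root T)[u uk uw].
apply: leq_trans (kids_half u uk); rewrite leq_mul2l /= subset_leq_card //.
apply/setIS/subsetP => x; rewrite !inE; exact: ancestor_trans.
Qed.

End ClippedLeafCount.

(* A node minimizing the total distance to the nodes of [F]. *)
Lemma exists_balanced (V : finType) (e : rel V) (F : {set V}) :
  is_tree e -> exists (c : V) (T : rooted_tree e c), balanced T F.
Proof.
move=> e_tree; have /card_gt0P[v _] : 0 < #|V| by case: e_tree.
pose D x := \sum_(w in F) dist e x w.
case: (@arg_minnP _ v xpredT D isT) => c _ c_min.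
exists c, (rooted_tree_of c e_tree); apply: balanced_from_kids => u uk.
by have := sum_dist_kid F uk; have := c_min u isT; rewrite /D; lia.
Qed.

(* The number of internal nodes of a heap with [L] leaves. *)
Definition internal_count (b L : nat) : nat := ((L - 3) %/ b.-1).+1.

Lemma internal_countP b L : 1 < b -> b < L ->
  (internal_count b L).-1 * b.-1 + 3 <= L <= internal_count b L * b.-1 + 2.
Proof.
move=> b_gt1 bL; rewrite /internal_count /= mulSn.
have := divn_eq (L - 3) b.-1; have := @ltn_pmod (L - 3) b.-1; lia.
Qed.

Lemma exists_frugal b L : 1 < b -> b < L ->
  exists (V : finType) (e : rel V) (root : V) (T : rooted_tree e root),
    frugal b (internal_count b L) L T.
Proof.
move=> b_gt1 bL; have /andP[L_ge L_le] := internal_countP b_gt1 bL.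
by do 4!eexists; apply: heap_frugal.
Qed.

Section FrugalComparison.

Variables (V : finType) (e : rel V) (root : V) (T : rooted_tree e root).
Variables (V' : finType) (e' : rel V') (root' : V') (G : rooted_tree e' root').
Variables b i : nat.
Hypothesis b_gt1 : 1 < b.
Hypothesis T_arity : arity_le T b.
Hypothesis G_frugal : frugal b i (leaf_count T root) G.

Lemma frugal_path_length (B : {set V}) : crown T B -> #|B| <= i ->
  exists B' : {set V'}, [/\ root' \in B', #|B'| = #|B|,
    path_length_outside G B' <= path_length_outside T B
    & path_length_outside T B <= path_length_outside G B' ->
      exists k, tight T b B k].
Proof.
move=> B_crown Bi; have B_gt0 : 0 < #|B|.
  by apply/card_gt0P; exists root; apply: crown_root B_crown.
have B_pred_lt : #|B|.-1 < i by rewrite prednK.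
have [B' [k [B'_crown + B'_tight]]] := frugal_crown G_frugal B_pred_lt.
rewrite prednK // => cardB'.
have := kraft_identity b_gt1 (frugal_arity G_frugal) B'_crown k.
have := kraft_identity b_gt1 T_arity B_crown k.
rewrite (frugal_leaf_count G_frugal) cardB' => kraft_B kraft_B'.
exists B'; split=> //; first exact: crown_root B'_crown.
  have : b.-1 * path_length_outside G B' < b.-1 * (path_length_outside T B).+1.
    by rewrite mulnS; rewrite /tight in B'_tight; lia.
  by rewrite ltn_mul2l => /andP[_].
move=> /(leq_mul (leqnn b.-1)) path_le; exists k.
by apply: leq_trans B'_tight; lia.
Qed.

Lemma frugal_internal_nodes : exists B' : {set V'},
  [/\ root' \in B', #|B'| = i & path_length_outside G B' = leaf_count T root].
Proof.
exists (~: [set x | childless G x]); split.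
- by rewrite !inE -card_kids_eq0 -lt0n ltnW // (frugal_root_kids G_frugal).
- rewrite cardsCs setCK -leaf_count_root (frugal_card G_frugal).
  by rewrite (frugal_leaf_count G_frugal) addKn.
rewrite -(frugal_leaf_count G_frugal) leaf_count_root -sum1_card.
apply: eq_big => x; rewrite !inE negbK //; exact: leaf_count_childless.
Qed.

Lemma clipped_frugal_le t : 0 < t -> ~~ childless T root ->
  clipped_leaf_count G t <= clipped_leaf_count T t.
Proof.
move=> t_gt0 root_internal; have B_crown := heavy_crown t_gt0 root_internal.
have := clipped_leaf_count_le T t (crown_root B_crown).
move/eqTleqif/(_ (heavy_separates T t)) ->.
have [Bi | iB] := leqP #|heavy T t| i.
  have [B' [rB' <- path_le _]] := frugal_path_length B_crown Bi.
  by apply: leq_trans (clipped_leaf_count_le G t rB') _; rewrite leq_add2l.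
have [B' [rB' cardB' pathB']] := frugal_internal_nodes.
apply: leq_trans (clipped_leaf_count_le G t rB') _; rewrite cardB' pathB'.
apply: leq_add; last exact: leaf_count_le_path_length_outside B_crown.
by rewrite leq_mul2l; apply/orP; right; lia.
Qed.

Lemma clipped_frugal_tight t (B : {set V}) : crown T B -> #|B| <= i ->
  separates T t B -> clipped_leaf_count T t <= clipped_leaf_count G t ->
  exists k, tight T b B k.
Proof.
move=> B_crown Bi B_sep clip_le.
have [B' [rB' cardB' _]] := frugal_path_length B_crown Bi; apply.
rewrite -(leq_add2l (t * #|B|.-1)).
rewrite -(eqTleqif (clipped_leaf_count_le T t (crown_root B_crown)) B_sep).
by apply: leq_trans clip_le _; rewrite -cardB'; apply: clipped_leaf_count_le.
Qed.

End FrugalComparison.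

Definition crowns_tight (V : finType) (e : rel V) (root : V)
    (T : rooted_tree e root) (b : nat) : Prop :=
  forall (B : {set V}) t, 0 < t <= (leaf_count T root)./2 ->
    crown T B -> separates T t B -> exists k, tight T b B k.

Definition sigma_LL_minimal (Delta : nat) (V : finType) (e : rel V) : Prop :=
  forall (V' : finType) (e' : rel V'),
    is_tree e' -> max_degree e' <= Delta -> #|leaves e'| = #|leaves e| ->
    sigma_LL e <= sigma_LL e'.

Lemma max_degree_arity_le (V : finType) (e : rel V) (root : V)
    (T : rooted_tree e root) b :
  max_degree e <= b.+1 <-> arity_le T b.
Proof.
split=> [/bigmax_leqP deg_le x | T_arity].
  by have := deg_le x isT; rewrite (degreeE T); case: eqP => _ /=; lia.
apply/bigmax_leqP => x _; rewrite (degreeE T).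
by have := T_arity x; case: eqP => _ /=; lia.
Qed.

Section Optimal.

Variables (V : finType) (e : rel V) (root : V) (T : rooted_tree e root).
Variable b : nat.
Hypotheses (b_gt1 : 1 < b) (e_degree : max_degree e <= b.+1).
Hypothesis e_minimal : sigma_LL_minimal b.+1 e.
Hypothesis b_lt_leaves : b < #|leaves e|.
Hypothesis T_balanced : balanced T (leaves e).

Local Notation L := #|leaves e|.

Lemma optimal_root_kids_gt1 : 1 < #|kids T root|.
Proof.
exact: balanced_root_kids_gt1 (leq_ltn_trans b_gt1 b_lt_leaves) T_balanced.
Qed.

Lemma optimal_leaf_count_root : leaf_count T root = L.
Proof. by rewrite leaf_count_root -leavesE // optimal_root_kids_gt1. Qed.

Lemma optimal_leaf_balanced : leaf_balanced T.
Proof.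
move=> u; rewrite optimal_leaf_count_root leaf_countE.
by rewrite -(leavesE optimal_root_kids_gt1); apply: T_balanced.
Qed.

Lemma optimal_root_internal : ~~ childless T root.
Proof. by rewrite -card_kids_eq0 -lt0n ltnW // optimal_root_kids_gt1. Qed.

Lemma optimal_clipped (V' : finType) (e' : rel V') (root' : V')
    (G : rooted_tree e' root') i t :
  frugal b i L G -> 0 < t <= L./2 ->
  clipped_leaf_count T t = clipped_leaf_count G t.
Proof.
move=> G_frugal /andP[t_gt0 t_le]; have G_root := frugal_root_kids G_frugal.
have clip_le s : 0 < s -> clipped_leaf_count G s <= clipped_leaf_count T s.
  move=> s_gt0; apply: (clipped_frugal_le b_gt1 _ (i := i)) => //.
  - exact/max_degree_arity_le.
  - by rewrite optimal_leaf_count_root.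
  - exact: optimal_root_internal.
have sigma_le : sigma_LL e <= sigma_LL e'.
  apply: e_minimal; first exact: rooted_tree_is_tree G.
    exact/(max_degree_arity_le G)/(frugal_arity G_frugal).
  by rewrite (leavesE G_root) -leaf_count_root (frugal_leaf_count G_frugal).
have sum_le : \sum_(s < L.-1) clipped_leaf_count T s./2.+1 <=
              \sum_(s < L.-1) clipped_leaf_count G s./2.+1.
  have := leq_trans sigma_le (sigma_LL_le_clipped G_root).
  rewrite (sigma_LL_clipped optimal_root_kids_gt1 optimal_leaf_balanced).
  by rewrite optimal_leaf_count_root (frugal_leaf_count G_frugal).
have clip_leqif (s : 'I_L.-1) (_ : true) :
    clipped_leaf_count G s./2.+1 <= clipped_leaf_count T s./2.+1
      ?= iff (clipped_leaf_count T s./2.+1 <= clipped_leaf_count G s./2.+1).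
  exact/leqif_geq/clip_le.
have := geq_leqif (leqif_sum clip_leqif).
rewrite sum_le => /esym/forall_inP all_le.
have t_lt : t.-1.*2 < L.-1 by rewrite -(odd_double_half L); lia.
apply/eqP; rewrite eqn_leq clip_le // andbT.
by have := all_le (Ordinal t_lt) isT; rewrite /= doubleK prednK.
Qed.

Lemma optimal_card : #|V| = L + internal_count b L.
Proof.
have [V' [e' [root' [G G_frugal]]]] := exists_frugal b_gt1 b_lt_leaves.
rewrite -(frugal_card G_frugal) -(clipped_leaf_count1 T).
rewrite -(clipped_leaf_count1 G) (optimal_clipped G_frugal) //.
by have := odd_double_half L; lia.
Qed.

Lemma optimal_crowns_tight : crowns_tight T b.
Proof.
move=> B t; rewrite optimal_leaf_count_root => t_range B_crown B_sep.
have [V' [e' [root' [G G_frugal]]]] := exists_frugal b_gt1 b_lt_leaves.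
have clip_eq := optimal_clipped G_frugal t_range.
rewrite -[in frugal _ _ _ _]optimal_leaf_count_root in G_frugal.
apply: (clipped_frugal_tight b_gt1 _ G_frugal B_crown _ B_sep).
- exact/max_degree_arity_le.
- rewrite -(leq_add2l L) optimal_leaf_count_root -optimal_card.
  rewrite -(cardC (mem B)) addnC leq_add2l -optimal_leaf_count_root.
  rewrite leaf_count_root subset_leq_card //.
  by apply/subsetP => x; rewrite !inE; apply: crown_childless.
by rewrite clip_eq.
Qed.

End Optimal.

(** * Layers *)

Record layered (V : finType) (e : rel V) (root : V) (T : rooted_tree e root)
    (b K : nat) : Prop := Layered {
  layered_gt0 : 0 < K;
  layered_above : forall x, depth T x < K -> #|kids T x| = b + (x == root);
  layered_below : forall x, K < depth T x -> childless T x;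
  layered_last : forall x, depth T x = K -> ~~ childless T x ->
    1 < #|kids T x| <= b }.

Section Layers.

Variables (V : finType) (e : rel V) (root : V) (T : rooted_tree e root).
Variables b K : nat.
Hypotheses (b_gt1 : 1 < b) (T_layered : layered T b K).
Implicit Types x y : V.

Local Notation depth := (depth T).
Local Notation kids := (kids T).
Local Notation childless := (childless T).
Local Notation leaf_count := (leaf_count T).

Definition bottom x : {set V} := [set y in descendants T x | depth y == K].

Definition bare x : bool := [forall y in bottom x, childless y].

Definition full x : bool := [forall y in bottom x, #|kids y| == b].

Lemma bottomP x y : reflect (ancestor T x y /\ depth y = K) (y \in bottom x).
Proof. by rewrite !inE; apply: (iffP andP) => -[xy /eqP]. Qed.

Lemma bottom_last x : depth x = K -> bottom x = [set x].
Proof.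
move=> xK; apply/setP => y; rewrite !inE; apply/andP/eqP => [[+ /eqP yK] | ->].
  by rewrite ancestor_same_depth ?xK // => /eqP.
by rewrite ancestor_refl xK.
Qed.

Lemma bottom_ancestor x y : ancestor T x y -> bottom y \subset bottom x.
Proof.
move=> xy; apply/subsetP => z /bottomP[yz zK]; apply/bottomP; split=> //.
exact: ancestor_trans xy yz.
Qed.

Lemma bare_ancestor x y : ancestor T x y -> bare x -> bare y.
Proof.
move=> xy /forall_inP x_bare; apply/forall_inP => z.
by move/(subsetP (bottom_ancestor xy))/x_bare.
Qed.

Lemma full_ancestor x y : ancestor T x y -> full x -> full y.
Proof.
move=> xy /forall_inP x_full; apply/forall_inP => z.
by move/(subsetP (bottom_ancestor xy))/x_full.
Qed.

Lemma bare_last x : depth x = K -> bare x = childless x.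
Proof.
move=> xK; rewrite /bare bottom_last //.
by apply/forall_inP/idP => [-> | x0 y]; rewrite ?inE // => /eqP ->.
Qed.

Lemma full_last x : depth x = K -> full x = (#|kids x| == b).
Proof.
move=> xK; rewrite /full bottom_last //.
by apply/forall_inP/idP => [-> | xb y]; rewrite ?inE // => /eqP ->.
Qed.

Lemma sum_bottom (F : V -> nat) x : depth x < K ->
  \sum_(y in bottom x) F y = \sum_(z in kids x) \sum_(y in bottom z) F y.
Proof.
have weighted z : \sum_(y in bottom z) F y =
    \sum_(y | depth y == K) ancestor T z y * F y.
  rewrite big_mkcond [RHS]big_mkcond; apply: eq_bigr => y _ /=.
  by rewrite !inE; case: ancestor; case: (depth y == K); rewrite ?mul1n.
move=> xK; rewrite weighted; under [RHS]eq_bigr => z _ do rewrite weighted.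
rewrite exchange_big; apply: eq_bigr => y /eqP yK.
rewrite ancestor_kids (_ : (x == y) = false) ?big_distrl //.
by apply: contraTF xK => /eqP ->; rewrite yK ltnn.
Qed.

Lemma card_kids_above x : 0 < depth x -> depth x < K -> #|kids x| = b.
Proof.
rewrite depth_gt0 => /negPf xr /(layered_above T_layered) ->.
by rewrite xr addn0.
Qed.

Lemma card_bottom m x : 0 < depth x -> depth x + m = K -> #|bottom x| = b ^ m.
Proof.
elim: m x => [|m IHm] x x_gt0 xm.
  by rewrite bottom_last ?cards1 // -xm addn0.
have xK : depth x < K by rewrite -xm; lia.
rewrite -sum1_card sum_bottom // expnS -{1}(card_kids_above x_gt0 xK).
rewrite -sum_nat_const; apply: eq_bigr => y yx; rewrite sum1_card.
by apply: IHm; rewrite (depth_kid yx) // addSnnS.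
Qed.

Lemma leaf_count_bottom x : 0 < depth x -> depth x <= K ->
  leaf_count x = \sum_(y in bottom x) leaf_count y.
Proof.
move=> x_gt0 /subnK; rewrite addnC; move: (K - _) => m.
elim: m x x_gt0 => [|m IHm] x x_gt0 xm.
  by rewrite bottom_last ?big_set1 // -xm addn0.
have xK : depth x < K by rewrite -xm; lia.
rewrite sum_bottom // leaf_count_internal.
  by apply: eq_bigr => y yx; apply: IHm; rewrite (depth_kid yx) // addSnnS.
by rewrite -card_kids_eq0 card_kids_above //; lia.
Qed.

Lemma leaf_count_last x : depth x = K -> leaf_count x = maxn 1 #|kids x|.
Proof.
move=> xK; have [x0 | x0] := boolP (childless x).
  by rewrite leaf_count_childless // (eqP x0) cards0.
rewrite leaf_count_internal // (eq_bigr (fun=> 1)) => [|y yx].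
  by rewrite sum1_card; have := layered_last T_layered xK x0; lia.
rewrite leaf_count_childless // (layered_below T_layered) //.
by rewrite (depth_kid yx) xK.
Qed.

Lemma card_kids_last x :
  depth x = K -> #|kids x| = 0 \/ 1 < #|kids x| <= b.
Proof.
move=> xK; have [/eqP -> | x0] := boolP (childless x).
  by left; rewrite cards0.
by right; apply: (layered_last T_layered).
Qed.

Lemma leaf_count_ge m x : 0 < depth x -> depth x + m = K ->
  b ^ m <= leaf_count x ?= iff bare x.
Proof.
move=> x_gt0 xm; rewrite -(card_bottom x_gt0 xm) -sum1_card.
rewrite leaf_count_bottom // -?xm ?leq_addr //.
apply: leqif_sum => y /bottomP[_ yK].
rewrite leaf_count_last // -card_kids_eq0.
by case: (card_kids_last yK) => kids_y; split; lia.
Qed.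

Lemma leaf_count_le m x : 0 < depth x -> depth x + m = K ->
  leaf_count x <= b ^ m.+1 ?= iff full x.
Proof.
move=> x_gt0 xm; rewrite expnSr -(card_bottom x_gt0 xm) -sum_nat_const.
rewrite leaf_count_bottom // -?xm ?leq_addr //.
apply: leqif_sum => y /bottomP[_ yK].
by rewrite leaf_count_last //; case: (card_kids_last yK) => kids_y; split; lia.
Qed.

End Layers.

Section Tightness.

Variables (V : finType) (e : rel V) (root : V) (T : rooted_tree e root).
Variable b : nat.
Hypotheses (b_gt1 : 1 < b) (T_arity : arity_le T b).

Local Notation depth := (depth T).
Local Notation childless := (childless T).
Local Notation leaf_count := (leaf_count T).
Local Notation L := (leaf_count root).

Hypothesis b_lt_L : b < L.
Hypotheses (T_balanced : leaf_balanced T) (T_tight : crowns_tight T b).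

Lemma root_internal : ~~ childless root.
Proof. by apply/negP => /(leaf_count_childless (T := T)); lia. Qed.

Lemma leaf_count_le_half u : u != root -> leaf_count u <= L./2.
Proof. by move/T_balanced; rewrite mul2n -{1}(odd_double_half L); lia. Qed.

Lemma tight_root_crown : exists k,
  [/\ crown T [set root], tight T b [set root] k
  & forall x, depth_outside T [set root] x = depth x].
Proof.
have root_crown : crown T [set root].
  split; rewrite ?inE // => x; rewrite inE => /eqP -> //; first by rewrite eqxx.
  exact: root_internal.
have [|| k k_tight] := T_tight (t := L./2) _ root_crown.
- by rewrite leqnn andbT half_gt0; lia.
- apply/forall_inP => u ur; rewrite inE (negPf ur).
  exact: leaf_count_le_half.
exists k; split=> // x; rewrite -(sum_ancestor_depth T).
by apply: eq_bigl => u; rewrite inE.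
Qed.

Lemma star_layered : (forall x, x != root -> childless x) -> layered T b 1.
Proof.
move=> star; split=> // [x x_lt1 | x x_gt1 | x x1].
- have -> : x = root by apply/eqP; rewrite -(depth_eq0 T) -leqn0 -ltnS.
  apply/eqP; rewrite eqn_leq T_arity eqxx addn1.
  have kids_leaf y : y \in kids T root -> leaf_count y = 1.
    by case/kidP => yr _; rewrite leaf_count_childless // star.
  move: b_lt_L; rewrite (leaf_count_internal root_internal).
  by rewrite (eq_bigr _ kids_leaf) sum1_card.
- by rewrite star // -(depth_gt0 T) ltnW.
- by rewrite star // -(depth_gt0 T) x1.
Qed.

(* For [k = 0] the slack does not bound the arity of the root from below, but
   then the tree is a star, and the number of leaves does. *)
Lemma tight_layered : exists K, layered T b K.
Proof.
have [k [root_crown k_tight depthE]] := tight_root_crown.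
have leaf_ge x : childless x -> k <= depth x.
  by rewrite -depthE; apply: (tight_leaf_depth_ge b_gt1 k_tight).
have internal_le x : ~~ childless x -> depth x <= k.
  have [-> | xr x0] := eqVneq x root; first by rewrite depth_root.
  by rewrite -depthE (tight_internal_depth b_gt1 root_crown k_tight) // inE.
have arity_ge2 x : x != root -> ~~ childless x -> 1 < #|kids T x|.
  by move=> xr; apply: (tight_arity_ge2 b_gt1 root_crown k_tight); rewrite inE.
have arity_full x : depth x < k -> #|kids T x| = b + (x == root).
  move=> xk; have x0 : ~~ childless x.
    by apply: contraL xk => /leaf_ge; rewrite -leqNgt.
  have [-> | xr] := eqVneq x root.
    rewrite (tight_arity_crown b_gt1 T_arity root_crown k_tight) ?inE ?eqxx //.
    by apply: leq_ltn_trans xk.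
  rewrite addn0 (tight_arity_full b_gt1 T_arity root_crown k_tight) ?inE //.
  by rewrite depthE.
have last_arity x : x != root -> ~~ childless x -> 1 < #|kids T x| <= b.
  move=> xr x0; rewrite arity_ge2 //=.
  by have := T_arity x; rewrite (negPf xr) addn0.
have below x : k < depth x -> childless x.
  by move=> kx; apply: contraTT kx => /internal_le; rewrite -leqNgt.
have [k0 | k_gt0] := posnP k.
  by exists 1; apply: star_layered => x xr; apply: below; rewrite k0 depth_gt0.
exists k; split=> // x xk; apply: last_arity.
by rewrite -(depth_gt0 T) xk.
Qed.

Section Twins.

Variables (K : nat) (u w : V).
Hypothesis T_layered : layered T b K.
Hypotheses (u_gt0 : 0 < depth u) (uK : depth u <= K).
Hypotheses (depth_w : depth w = depth u) (uw : u != w).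
Hypotheses (leaf_count_wu : leaf_count w <= leaf_count u).
Hypothesis w_not_bare : ~~ bare T K w.

Definition twin_crown : {set V} :=
  [set x | (x == root) || (leaf_count u <= leaf_count x) && (x != w)].

Let u_root : u != root. Proof. by rewrite -(depth_gt0 T). Qed.

Let w_root : w != root. Proof. by rewrite -(depth_gt0 T) depth_w. Qed.

Let leaf_count_w_gt : b ^ (K - depth u) < leaf_count w.
Proof.
have w_gt0 : 0 < depth w by rewrite depth_w.
have wK : depth w + (K - depth u) = K by rewrite depth_w subnKC.
by rewrite (ltn_leqif (leaf_count_ge b_gt1 T_layered w_gt0 wK)).
Qed.

Lemma deep_notin_twin_crown x : depth u < depth x -> x \notin twin_crown.
Proof.
move=> ux; rewrite inE negb_or -(depth_gt0 T) (leq_trans _ ux) //=.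
rewrite negb_and -ltnNge; apply/orP; left; apply: leq_trans leaf_count_wu.
apply: leq_ltn_trans leaf_count_w_gt.
have [xK | Kx] := leqP (depth x) K; last first.
  by rewrite (leaf_count_childless (layered_below T_layered Kx)) expn_gt0; lia.
have x_gt0 : 0 < depth x by apply: leq_trans ux.
apply: leq_trans (leaf_count_le b_gt1 T_layered x_gt0 (subnKC xK)) _.
by rewrite leq_exp2l; lia.
Qed.

Lemma shallow_in_twin_crown x : depth x < depth u -> x \in twin_crown.
Proof.
move=> xu; rewrite inE; have [// | xr] := eqVneq x root.
rewrite (_ : x != w) ?andbT; last first.
  by apply: contraTneq xu => ->; rewrite depth_w ltnn.
apply: leq_trans (leaf_count_le b_gt1 T_layered u_gt0 (subnKC uK)) _.
rewrite -(depth_gt0 T) in xr; have xK : depth x <= K by lia.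
apply: leq_trans (leaf_count_ge b_gt1 T_layered xr (subnKC xK)).
by rewrite leq_exp2l; lia.
Qed.

Lemma u_in_twin_crown : u \in twin_crown.
Proof. by rewrite inE leqnn uw orbT. Qed.

Lemma w_notin_twin_crown : w \notin twin_crown.
Proof. by rewrite inE (negPf w_root) eqxx andbF. Qed.

Lemma twin_crownP : crown T twin_crown.
Proof.
split=> [|x xB xr|x]; first by rewrite inE eqxx.
  apply: shallow_in_twin_crown; rewrite -(depth_parent T xr) leqNgt.
  by apply: contraL xB; apply: deep_notin_twin_crown.
rewrite inE => /orP[/eqP -> | /andP[ux _]]; first exact: root_internal.
apply/negP => x0; rewrite (leaf_count_childless x0) in ux.
have := leq_trans leaf_count_w_gt (leq_trans leaf_count_wu ux).
by rewrite ltnS leqn0 expn_eq0; lia.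
Qed.

Lemma twin_crown_separates : separates T (leaf_count u) twin_crown.
Proof.
apply/forall_inP => x xr; rewrite inE (negPf xr) /=.
case: ifP => [/andP[] // | /negbT]; rewrite negb_and -ltnNge negbK.
by case/orP => [/ltnW // | /eqP ->].
Qed.

Lemma depth_outside_below_w x :
  ancestor T w x -> depth_outside T twin_crown x = (depth x - depth w).+1.
Proof.
move=> wx; rewrite (depth_outside_below (u := w)) //.
  rewrite (depth_outside_parent T _ w_root) w_notin_twin_crown.
  rewrite (depth_outside_crown twin_crownP) // shallow_in_twin_crown //.
  by rewrite -depth_w (depth_parent T w_root).
move=> y wy yw; apply: deep_notin_twin_crown; rewrite -depth_w.
by rewrite (ltn_ancestor wy) // eq_sym.
Qed.

Lemma depth_outside_below_u x :
  ancestor T u x -> depth_outside T twin_crown x = depth x - depth u.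
Proof.
move=> ux; rewrite (depth_outside_below (u := u)) //.
  by rewrite (depth_outside_crown twin_crownP) // u_in_twin_crown.
move=> y uy yu; apply: deep_notin_twin_crown.
by rewrite (ltn_ancestor uy) // eq_sym.
Qed.

(* In the forest, [w] has depth 1 and [u] depth 0: a last node below [u] that
   is not full would be too shallow for the depth of the leaves below [w]. *)
Lemma twin_full : full T b K u.
Proof.
have [|k k_tight] := T_tight _ twin_crownP twin_crown_separates.
  by rewrite leaf_count_gt0 leaf_count_le_half.
have k_gt : K - depth u < k.
  move: w_not_bare; rewrite negb_forall_in => /exists_inP[y /bottomP[wy yK] y0].
  rewrite -depth_w -yK -depth_outside_below_w //.
  apply: (tight_internal_depth b_gt1 twin_crownP k_tight) => //.
  have [<- | wy'] := eqVneq w y; first exact: w_notin_twin_crown.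
  by apply: deep_notin_twin_crown; rewrite -depth_w ltn_ancestor.
apply/forall_inP => y /bottomP[uy yK]; apply/eqP.
have [<- | uy'] := eqVneq u y.
  rewrite (tight_arity_crown b_gt1 T_arity twin_crownP k_tight u_in_twin_crown).
    by rewrite (negPf u_root) addn0.
  exact: leq_ltn_trans k_gt.
have yB : y \notin twin_crown by rewrite deep_notin_twin_crown // ltn_ancestor.
have y_lt : depth_outside T twin_crown y < k.
  by rewrite depth_outside_below_u // yK.
apply: (tight_arity_full b_gt1 T_arity twin_crownP k_tight) => //.
by apply: contraL y_lt => /(tight_leaf_depth_ge b_gt1 k_tight); rewrite -leqNgt.
Qed.

End Twins.

Lemma full_or_bare K u w : layered T b K -> 0 < depth u <= K ->
  depth w = depth u -> u != w -> leaf_count w <= leaf_count u ->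
  full T b K u \/ bare T K w.
Proof.
move=> T_layered /andP[u_gt0 uK] depth_w uw w_le_u.
by have [|/twin_full] := boolP (bare T K w); [right | left; auto].
Qed.

End Tightness.

(** * Left-to-right orders *)

Record left_filled (V : finType) (e : rel V) (root : V) (T : rooted_tree e root)
    (lt : rel V) (R b K : nat) : Prop := LeftFilled {
  filled_above : forall x, depth T x < K ->
    #|kids T x| = if x == root then R else b;
  filled_below : forall x, K < depth T x -> #|kids T x| = 0;
  filled_arity : forall x, K <= depth T x -> #|kids T x| <= b;
  filled_left : forall x y, K <= depth T x -> depth T x = depth T y -> lt x y ->
    #|kids T x| = b \/ #|kids T y| = 0 }.

Section LeafOrder.

Variables (V : finType) (e : rel V) (root : V) (T : rooted_tree e root).
Implicit Types x y z : V.

Local Notation depth := (depth T).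
Local Notation parent := (parent T).
Local Notation leaf_count := (leaf_count T).

Definition sibling_before x y : bool :=
  (leaf_count y < leaf_count x) ||
  (leaf_count x == leaf_count y) && (enum_rank x < enum_rank y).

(* Nodes of one level are compared through their highest distinct ancestors,
   the one with more leaves coming first. *)
Fixpoint before_at (n : nat) x y : bool :=
  if parent x == parent y then sibling_before x y
  else if n is n'.+1 then before_at n' (parent x) (parent y) else false.

Definition before x y : bool := before_at (depth x) x y.

Lemma beforeE x y : x != root ->
  before x y = if parent x == parent y then sibling_before x y
               else before (parent x) (parent y).
Proof. by move=> xr; rewrite /before (depth_parent T xr). Qed.

Lemma before_irr : irreflexive before.
Proof.
by move=> x; rewrite /before; case: (depth x) => [|n] /=;
  rewrite eqxx /sibling_before !ltnn andbF.
Qed.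

Lemma same_depth_root x y : depth x = depth y -> (x == root) = (y == root).
Proof. by move=> xy; rewrite -!(depth_eq0 T) xy. Qed.

Lemma same_depth_parent x y :
  x != root -> depth x = depth y -> depth (parent x) = depth (parent y).
Proof.
move=> xr xy; have yr : y != root by rewrite -(same_depth_root xy).
by apply: succn_inj; rewrite -!depth_parent.
Qed.

Lemma before_trans x y z : depth x = depth y -> depth y = depth z ->
  before x y -> before y z -> before x z.
Proof.
elim/(rooted_ind T): x y z => [|x xr IHx] y z xy yz.
  have := same_depth_root xy; rewrite eqxx => /esym/eqP ->.
  by rewrite before_irr.
have yr : y != root by rewrite -(same_depth_root xy).
have pxy := same_depth_parent xr xy; have pyz := same_depth_parent yr yz.
rewrite (beforeE y xr) (beforeE z xr) (beforeE z yr).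
have [-> | nxy] := eqVneq (parent x) (parent y).
  by case: ifP => // _; rewrite /sibling_before; lia.
have [<- | nyz] := eqVneq (parent y) (parent z); first by rewrite (negPf nxy).
have [<- | _] := eqVneq (parent x) (parent z); last exact: IHx.
by move=> bxy byx; have := IHx _ _ pxy (esym pxy) bxy byx; rewrite before_irr.
Qed.

Lemma before_total x y :
  depth x = depth y -> x != y -> before x y || before y x.
Proof.
elim/(rooted_ind T): x y => [|x xr IHx] y xy nxy.
  by have := same_depth_root xy; rewrite eqxx eq_sym (negPf nxy).
have yr : y != root by rewrite -(same_depth_root xy).
rewrite (beforeE y xr) (beforeE x yr) (eq_sym (parent y)).
case: ifP => [_ | /negbT]; last exact: IHx (same_depth_parent xr xy).
rewrite /sibling_before; have : enum_rank x != enum_rank y :> nat.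
  by rewrite val_eqE (inj_eq enum_rank_inj).
lia.
Qed.

Lemma before_kids x y x' y' : before x y ->
  x' \in kids T x -> y' \in kids T y -> before x' y'.
Proof.
move=> xy /kidP[x'r px'] /kidP[_ py']; rewrite beforeE // px' py'.
by case: eqP xy => // ->; rewrite before_irr.
Qed.

Lemma before_left_to_right : left_to_right e root before.
Proof.
split; first exact: before_irr.
- by move=> x y z; rewrite !(levelE T); apply: before_trans.
- by move=> x y; rewrite !(levelE T); apply: before_total.
- move=> x y x' y' _; rewrite !(childrenE T); exact: before_kids.
Qed.

Section Layered.

Variables b K : nat.
Hypothesis T_layered : layered T b K.
Hypothesis full_or_bare_twins : forall u w, 0 < depth u <= K ->
  depth w = depth u -> u != w -> leaf_count w <= leaf_count u ->
  full T b K u \/ bare T K w.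

(* Fullness and bareness are inherited from the parents when these differ. *)
Lemma before_full_or_bare x y : depth x = depth y -> 0 < depth x <= K ->
  before x y -> full T b K x \/ bare T K y.
Proof.
elim/(rooted_ind T): x y => [|x xr IHx] y xy; first by rewrite depth_root.
have yr : y != root by rewrite -(same_depth_root xy).
move=> xK; rewrite beforeE //; case: eqVneq => [_ | nxy] bxy.
  apply: full_or_bare_twins => //; last first.
    by move: bxy; rewrite /sibling_before; lia.
  by apply: contraTneq bxy => ->; rewrite /sibling_before !ltnn andbF.
have pxy := same_depth_parent xr xy.
have px_gt0 : 0 < depth (parent x).
  rewrite depth_gt0; apply: contra_neq nxy => px.
  by rewrite px; apply/esym/eqP; rewrite -(same_depth_root pxy) px.
have pK : 0 < depth (parent x) <= K by have := depth_parent T xr; lia.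
case: (IHx _ pxy pK bxy) => [px_full | py_bare].
  by left; apply: full_ancestor px_full; apply/ancestor_kid/kid_of_parent.
by right; apply: bare_ancestor py_bare; apply/ancestor_kid/kid_of_parent.
Qed.

Lemma layered_left_filled : left_filled T before b.+1 b K.
Proof.
have below x : K < depth x -> #|kids T x| = 0.
  by move/(layered_below T_layered)/eqP => ->; rewrite cards0.
split=> // [x xK | x | x y].
- rewrite (layered_above T_layered xK).
  by case: eqP => _; rewrite ?addn1 ?addn0.
- rewrite leq_eqVlt => /orP[/eqP/esym xK | /below -> //].
  by case: (card_kids_last T_layered xK) => [-> | /andP[]].
rewrite leq_eqVlt => /orP[/eqP/esym xK | Kx] xy bxy; last first.
  by right; apply: below; rewrite -xy.
have [||y_bare] := before_full_or_bare xy _ bxy.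
- by rewrite xK (layered_gt0 T_layered) leqnn.
- by rewrite full_last // => /eqP; left.
by right; apply/eqP; rewrite card_kids_eq0 -(bare_last (K := K)) // -xy.
Qed.

End Layered.

End LeafOrder.

Lemma M_S R Delta k : M R Delta k.+1 = M R Delta k + R * Delta.-1 ^ k.
Proof. by rewrite /M big_ord_recr addnA. Qed.

Section Family.

Variables (V : finType) (e : rel V) (root : V) (T : rooted_tree e root).
Variables (lt : rel V) (R b K : nat).
Hypothesis b_gt0 : 0 < b.
Hypothesis lt_ltr : left_to_right e root lt.
Hypothesis T_filled : left_filled T lt R b K.

Local Notation kids := (kids T).
Local Notation depth := (depth T).
Local Notation last_kids := (\sum_(x | depth x == K) #|kids x|).

Lemma depth_le_last x : depth x <= K.+1.
Proof.
have [-> | xr] := eqVneq x root; first by rewrite depth_root.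
rewrite (depth_parent T xr) ltnS leqNgt.
apply/negP => /(filled_below T_filled)/eqP.
by rewrite card_kids_eq0 (negPf (kid_internal (kid_of_parent T xr))).
Qed.

Lemma card_next_depth j :
  #|[set x | depth x == j.+1]| = \sum_(x | depth x == j) #|kids x|.
Proof.
rewrite -sum1dep_card big_mkcond [RHS]big_mkcond /=.
transitivity (\sum_(w | w != root) (depth (parent T w) == j)).
  rewrite [RHS]big_mkcond; apply: eq_bigr => x _ /=.
  have [-> | xr] := eqVneq x root; first by rewrite depth_root.
  by rewrite (depth_parent T xr) eqSS; case: ifP.
rewrite (sum_parent T (fun x => depth x == j)); apply: eq_bigr => x _.
by case: ifP; rewrite ?muln1 ?muln0.
Qed.

Lemma card_depth0 : #|[set x | depth x == 0]| = 1.
Proof.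
by rewrite -(cards1 root); apply: eq_card => x; rewrite !inE depth_eq0.
Qed.

Lemma card_depth j : j < K -> #|[set x | depth x == j.+1]| = R * b ^ j.
Proof.
elim: j => [|j IHj] jK; rewrite card_next_depth.
  rewrite (eq_bigl (pred1 root)) => [|x]; last by rewrite depth_eq0.
  by rewrite big_pred1_eq (filled_above T_filled) ?depth_root // eqxx muln1.
rewrite (eq_bigr (fun=> b)) => [|x /eqP xj]; last first.
  by rewrite (filled_above T_filled) ?xj // -(depth_eq0 T) xj.
by rewrite sum_nat_cond_const IHj ?expnSr ?mulnA // ltnW.
Qed.

Lemma card_depth_le j :
  #|[set x | depth x <= j]| = 1 + \sum_(t < j) #|[set x | depth x == t.+1]|.
Proof.
elim: j => [|j IHj].
  rewrite big_ord0 addn0 -[RHS]card_depth0.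
  by apply: eq_card => x; rewrite !inE leqn0.
rewrite big_ord_recr /= addnA -IHj -cardsUI.
have -> : [set x | depth x <= j] :&: [set x | depth x == j.+1] = set0.
  by apply/setP => x; rewrite !inE; lia.
by rewrite cards0 addn0; apply: eq_card => x; rewrite !inE leq_eqVlt ltnS orbC.
Qed.

Lemma card_filled : #|V| = M R b.+1 K + last_kids.
Proof.
have -> : #|V| = #|[set x | depth x <= K.+1]|.
  by rewrite -cardsT; apply: eq_card => x; rewrite !inE depth_le_last.
rewrite card_depth_le big_ord_recr /= card_next_depth addnA; congr (_ + _ + _).
by apply: eq_bigr => t _; rewrite card_depth.
Qed.

Lemma positionE x : depth x = K ->
  position e root lt x = #|[set y | (depth y == K) && lt y x]|.
Proof.
by move=> xK; apply: eq_card => y; rewrite !inE !(levelE T) xK.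
Qed.

Lemma last_kids_split x : depth x = K -> last_kids =
  \sum_(y | (depth y == K) && lt y x) #|kids y| + #|kids x| +
  \sum_(y | (depth y == K) && ~~ lt y x && (y != x)) #|kids y|.
Proof.
case: lt_ltr => lt_irr _ _ _ xK; rewrite (bigID (fun y => lt y x)) /=.
by rewrite [X in _ + X](bigD1 x) ?xK ?lt_irr ?eqxx //= addnA.
Qed.

Lemma sum_kids_before_full x : depth x = K -> 0 < #|kids x| ->
  \sum_(y | (depth y == K) && lt y x) #|kids y| = position e root lt x * b.
Proof.
move=> xK x_gt0; rewrite positionE // -sum_nat_cond_const.
apply: eq_bigr => y /andP[/eqP yK yx].
by case: (filled_left T_filled _ _ yx); rewrite ?yK ?xK //; lia.
Qed.

Lemma sum_kids_before_le x : depth x = K ->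
  \sum_(y | (depth y == K) && lt y x) #|kids y| <= position e root lt x * b.
Proof.
move=> xK; rewrite positionE // -sum_nat_cond_const; apply: leq_sum => y.
by case/andP => /eqP yK _; apply: (filled_arity T_filled); rewrite yK.
Qed.

Lemma sum_kids_after x : depth x = K -> #|kids x| != b ->
  \sum_(y | (depth y == K) && ~~ lt y x && (y != x)) #|kids y| = 0.
Proof.
case: lt_ltr => _ _ lt_total _ xK xb.
apply: big1 => y /andP[/andP[/eqP yK yx] neq_yx].
have := lt_total y x; rewrite !(levelE T) yK xK (negPf yx).
move=> /(_ erefl neq_yx) xy.
have [] := filled_left T_filled _ _ xy; rewrite ?xK ?yK //.
by move=> xb'; rewrite xb' eqxx in xb.
Qed.

Lemma kids_by_position x : depth x = K ->
  #|kids x| =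
    if position e root lt x < last_kids %/ b then b
    else if position e root lt x == last_kids %/ b then last_kids %% b else 0.
Proof.
move=> xK; have kids_le : #|kids x| <= b.
  by apply: (filled_arity T_filled); rewrite xK.
rewrite (last_kids_split xK); have [xb | xb] := eqVneq #|kids x| b.
  rewrite xb ifT // leq_divRL // sum_kids_before_full ?xb // mulSn [b + _]addnC.
  by rewrite leq_addr.
rewrite sum_kids_after // addn0.
have [x0 | x_gt0] := posnP #|kids x|; last first.
  have x_lt : #|kids x| < b by rewrite ltn_neqAle xb.
  rewrite sum_kids_before_full // divnMDl // modnMDl (divn_small x_lt) addn0.
  by rewrite ltnn eqxx modn_small.
rewrite x0 addn0; have := sum_kids_before_le xK.
set N := \sum_(y | _) _ => N_le.
rewrite ltnNge -[position e root lt x](mulnK _ b_gt0) leq_div2r // mulnK //=.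
case: eqP => // pos_eq.
apply/esym/eqP; rewrite -leqn0 -(leq_add2l (N %/ b * b)).
by rewrite -divn_eq addn0 -pos_eq.
Qed.

Hypothesis R_b : K = 0 -> R = b.

Lemma card_last_depth : #|[set x | depth x == K]| * b = R * b ^ K.
Proof.
have [K0 | K_gt0] := posnP K.
  by rewrite R_b // K0 card_depth0 expn0 muln1 mul1n.
by rewrite -(prednK K_gt0) card_depth ?prednK // -mulnA -expnSr prednK.
Qed.

Lemma last_kids_le :
  last_kids <= R * b ^ K ?= iff [forall (x | depth x == K), #|kids x| == b].
Proof.
rewrite -card_last_depth -sum_nat_cond_const; apply: leqif_sum => x /eqP xK.
by apply/leqif_eq/(filled_arity T_filled); rewrite xK.
Qed.

Lemma card_root_children : #|children e root root| = minn (#|V| - 1) R.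
Proof.
rewrite (childrenE T); have [K0 | K_gt0] := posnP K.
  have -> : #|V| - 1 = #|kids root|.
    rewrite card_filled /M K0 big_ord0 addKn (eq_bigl (pred1 root)) => [|x].
      by rewrite big_pred1_eq.
    by rewrite depth_eq0.
  by rewrite (minn_idPl _) // R_b // (filled_arity T_filled) // K0.
have kids_root : #|kids root| = R.
  by rewrite (filled_above T_filled) ?depth_root // eqxx.
rewrite (minn_idPr _) // -kids_root subn1 -(cardC1 root) subset_leq_card //.
by apply/subsetP => x /kidP[].
Qed.

Lemma filled_in_family : 0 < R -> in_family R b.+1 e root lt.
Proof.
move=> R_gt0; split=> //; first exact: rooted_tree_is_tree T.
have [/eqP all_full | some_not_full] := boolP (last_kids == R * b ^ K).
  have cardV : #|V| = M R b.+1 K.+1 by rewrite M_S card_filled all_full.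
  exists K.+1; rewrite /= cardV subnn div0n mod0n; split.
  - rewrite leqnn (M_S _ _ K.+1) -addn1 leq_add2l muln_gt0 R_gt0.
    by rewrite expn_gt0 b_gt0.
  - by move=> x; rewrite (levelE T) ltnW // ltnS depth_le_last.
  - by rewrite -cardV card_root_children.
  - move=> x; rewrite (levelE T) (childrenE T) => /andP[x_gt0].
    rewrite leq_eqVlt => /orP[xK | xK].
      have /forall_inP full_last : [forall (x | depth x == K), #|kids x| == b].
        by rewrite -(eq_leqif last_kids_le) all_full.
      exact/eqP/full_last.
    by rewrite (filled_above T_filled) // -(depth_eq0 T) gtn_eqF.
  - move=> x; rewrite (levelE T) (childrenE T) => xK.
    by rewrite (filled_below T_filled) ?xK // ltn0; case: ifP.
have last_kids_lt : last_kids < R * b ^ K.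
  by rewrite ltn_neqAle some_not_full last_kids_le.
have last_kidsE : #|V| - M R b.+1 K = last_kids by rewrite card_filled addKn.
exists K; rewrite /= last_kidsE; split.
- by rewrite M_S card_filled leq_addr ltn_add2l.
- by move=> x; rewrite (levelE T) depth_le_last.
- exact: card_root_children.
- move=> x; rewrite (levelE T) (childrenE T) => /andP[x_gt0 xK].
  by rewrite (filled_above T_filled) -?(depth_eq0 T) ?gtn_eqF //; lia.
- by move=> x; rewrite (levelE T) (childrenE T); apply: kids_by_position.
Qed.

End Family.

(** * Subtrees *)

Section Subtrees.

Variables (V : finType) (e : rel V) (root : V) (T : rooted_tree e root).
Implicit Types u w x y : V.

Local Notation ancestor := (ancestor T).
Local Notation parent := (parent T).

Lemma ancestor_on_path u w p :
  path e w p -> last w p = root -> ancestor u w -> u \in w :: p.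
Proof.
elim: p w => [|y p IHp] w /= => [_ -> | /andP[wy yp] p_root].
  by rewrite ancestor_root inE.
rewrite inE ancestorE; case: eqVneq => //= _ /andP[wr u_pw].
apply: IHp => //; move: wy; rewrite (edgeE T) => /orP[] /andP[yr /eqP pE].
  by rewrite -pE.
by rewrite ancestorE yr pE ancestorE wr u_pw !orbT.
Qed.

(* A walk to the root that goes down along an edge must come back through its
   upper end. *)
Lemma uniq_path_ancestor u w p : path e w p -> last w p = root ->
  uniq (w :: p) -> u \in w :: p -> ancestor u w.
Proof.
elim: p w => [|y p IHp] w /= => [_ -> _ | /andP[wy yp] p_root /andP[wp p_uniq]].
  by rewrite inE ancestor_root.
rewrite inE => /orP[/eqP -> | u_p]; first exact: ancestor_refl.
have u_y := IHp y yp p_root p_uniq u_p.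
move: wy; rewrite (edgeE T) => /orP[] /andP[r /eqP pE].
  by rewrite ancestorE r pE u_y orbT.
have wy : ancestor w y by rewrite ancestorE r pE ancestor_refl orbT.
by rewrite (ancestor_on_path yp p_root wy) in wp.
Qed.

Lemma subtreeE u : subtree e root u = descendants T u.
Proof.
apply/setP => w; rewrite !inE; apply/existsP/idP.
  case=> n /existsP[p /and4P[wp /eqP p_root p_uniq u_p]].
  exact: uniq_path_ancestor wp p_root p_uniq u_p.
move=> uw; have /connectP[p0 wp0 p0_root] := connect_to_root T w.
case/shortenP: wp0 p0_root => p wp p_uniq _ /esym p_root.
have p_lt : size p < #|V|.
  by have := max_card (mem (w :: p)); rewrite (card_uniqP p_uniq).
exists (Ordinal p_lt); apply/existsP; exists (in_tuple p).
by apply/and4P; split; rewrite //= ?p_root // (ancestor_on_path wp).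
Qed.

Lemma descendants_component u : u != root ->
  descendants T u \subset component_without e root u.
Proof.
move=> ur; apply/subsetP => w; rewrite !inE.
elim/(rooted_ind T): w => [|w wr IHw].
  by rewrite ancestor_root (negPf ur).
rewrite ancestorE wr => /orP[/eqP -> // | uw].
apply: connect_trans (IHw uw) (connect1 _); rewrite /= wr (rooted_tree_sym T).
by rewrite parent_edge // (ancestor_neq_root ur uw).
Qed.

Lemma central_balanced : central e root -> balanced T [set: V].
Proof.
move=> root_central u ur; rewrite setTI cardsT.
apply: leq_trans (root_central u ur); rewrite leq_mul2l /=.
exact/subset_leq_card/descendants_component.
Qed.

Variable u : V.
Hypothesis u_subtree : u \in subtree e root u.

Local Notation subtree_node := {x : V | x \in subtree e root u}.
Implicit Types s t : subtree_node.

Definition subtree_root : subtree_node :=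
  exist (fun w => w \in subtree e root u) u u_subtree.

Definition subtree_parent s : subtree_node :=
  insubd subtree_root (parent (val s)).

Definition subtree_depth s : nat := depth T (val s) - depth T u.

Lemma in_subtree w : (w \in subtree e root u) = ancestor u w.
Proof. by rewrite subtreeE inE. Qed.

Lemma subtree_ancestor s : ancestor u (val s).
Proof. by rewrite -in_subtree; apply: valP. Qed.

Lemma subtree_depthK s : subtree_depth s + depth T u = depth T (val s).
Proof. exact/subnK/leq_ancestor/subtree_ancestor. Qed.

Lemma subtree_depth_eq s t :
  subtree_depth s = subtree_depth t -> depth T (val s) = depth T (val t).
Proof. by rewrite -!subtree_depthK => ->. Qed.

Lemma val_subtree_parent s :
  s != subtree_root -> val (subtree_parent s) = parent (val s).
Proof.
rewrite -val_eqE /= => su; rewrite val_insubd in_subtree.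
by rewrite ancestor_parent ?subtree_ancestor // eq_sym.
Qed.

Lemma subtree_neq_root s : s != subtree_root -> val s != root.
Proof.
apply: contra => /eqP sr; rewrite -val_eqE /= eq_sym.
by have := subtree_ancestor s; rewrite {1}sr ancestor_root sr.
Qed.

Lemma subtree_edge s t :
  (val s != root) && (parent (val s) == val t) =
  (s != subtree_root) && (subtree_parent s == t).
Proof.
have [-> | su] /= := eqVneq s subtree_root; last first.
  by rewrite subtree_neq_root //= -val_eqE val_subtree_parent.
apply/negP => /andP[ur /eqP pu].
have := leq_ancestor (subtree_ancestor t); rewrite -[val t]pu.
by rewrite (depth_parent T ur) ltnn.
Qed.

Lemma subtree_depth_root : subtree_depth subtree_root = 0.
Proof. exact: subnn. Qed.

Lemma subtree_depth_parent s : s != subtree_root ->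
  subtree_depth s = (subtree_depth (subtree_parent s)).+1.
Proof.
move=> su; apply/eqP; rewrite -(eqn_add2r (depth T u)) addSn !subtree_depthK.
by rewrite val_subtree_parent // -depth_parent ?subtree_neq_root.
Qed.

Lemma subtree_edgeE s t : induced e (subtree e root u) s t =
  (s != subtree_root) && (subtree_parent s == t) ||
  (t != subtree_root) && (subtree_parent t == s).
Proof. by rewrite /induced (edgeE T) !subtree_edge. Qed.

Definition rooted_subtree :
    rooted_tree (induced e (subtree e root u)) subtree_root :=
  RootedTree subtree_depth_root subtree_depth_parent subtree_edgeE.

Lemma depth_subtree s : depth T (val s) = depth rooted_subtree s + depth T u.
Proof. by rewrite subtree_depthK. Qed.

Lemma subtree_kid s t :
  (t \in kids rooted_subtree s) = (val t \in kids T (val s)).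
Proof. by rewrite !inE -subtree_edge. Qed.

Lemma card_subtree_kids s : #|kids rooted_subtree s| = #|kids T (val s)|.
Proof.
rewrite -(card_imset _ val_inj); apply: eq_card => y; apply/imsetP/idP.
  by case=> t ts ->; rewrite -subtree_kid.
move=> ys; have yu : y \in subtree e root u.
  rewrite in_subtree.
  exact: ancestor_trans (subtree_ancestor s) (ancestor_kid ys).
by exists (exist (fun w => w \in subtree e root u) y yu); rewrite ?subtree_kid.
Qed.

Lemma subtree_left_to_right (lt : rel V) : left_to_right e root lt ->
  left_to_right (induced e (subtree e root u)) subtree_root
    (induced lt (subtree e root u)).
Proof.
case=> lt_irr lt_trans lt_total lt_kids; split.
- by move=> s; apply: lt_irr.
- move=> s t s'; rewrite !(levelE rooted_subtree).
  move=> /subtree_depth_eq st /subtree_depth_eq ts.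
  by apply: lt_trans; rewrite !(levelE T).
- move=> s t; rewrite !(levelE rooted_subtree) => /subtree_depth_eq st.
  by rewrite -val_eqE; apply: lt_total; rewrite !(levelE T).
move=> s t s' t'; rewrite !(levelE rooted_subtree) !(childrenE rooted_subtree).
rewrite !subtree_kid -!(childrenE T) => /subtree_depth_eq st.
by apply: lt_kids; rewrite !(levelE T).
Qed.

Lemma subtree_left_filled (lt : rel V) R b K : u != root ->
  left_filled T lt R b K ->
  left_filled rooted_subtree (induced lt (subtree e root u)) b b
    (K - depth T u).
Proof.
move=> ur T_filled; split=> [s | s | s | s t]; rewrite !card_subtree_kids => sK.
- rewrite if_same (filled_above T_filled); last by rewrite depth_subtree; lia.
  by rewrite (negPf (ancestor_neq_root ur (subtree_ancestor s))).
- by apply: (filled_below T_filled); rewrite depth_subtree; lia.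
- by apply: (filled_arity T_filled); rewrite depth_subtree; lia.
move=> /subtree_depth_eq; apply: (filled_left T_filled).
by rewrite depth_subtree; lia.
Qed.

End Subtrees.

(** * Central nodes *)

Lemma max_degree_le_leaves (V : finType) (e : rel V) :
  is_tree e -> 1 < max_degree e -> max_degree e <= #|leaves e|.
Proof.
move=> e_tree; have V_gt0 : 0 < #|V| by case: e_tree.
rewrite /max_degree; have [z ->] := eq_bigmax (degree e) V_gt0.
pose T := rooted_tree_of z e_tree; rewrite (degreeE T) eqxx addn0 => kids_gt1.
by rewrite (leavesE kids_gt1) -leaf_count_root card_kids_le_leaf_count.
Qed.

Lemma card_descendants (V : finType) (e : rel V) (root : V)
    (T : rooted_tree e root) b u : arity_le T b -> u != root ->
  #|descendants T u| <= 1 + b * (#|descendants T u| - leaf_count T u).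
Proof.
move=> T_arity ur; have cardE : #|descendants T u| =
    1 + \sum_x #|kids T x| * ancestor T u x.
  rewrite -(sum_parent T (ancestor T u)) -[descendants T u]setTI -sum_ancestor.
  rewrite (eq_bigl predT) => [|x]; last by rewrite inE.
  rewrite (bigD1 root) //= ancestor_root (negPf ur) add0n.
  under eq_bigr => w wr do rewrite ancestor_count //.
  rewrite big_split /=; congr (_ + _).
  rewrite (bigD1 u) //= eqxx big1 // => w /andP[_ /negPf].
  by rewrite eq_sym => ->.
have internalE : #|descendants T u| - leaf_count T u =
    \sum_x ~~ childless T x * ancestor T u x.
  rewrite leaf_countE setIC -cardsD -sum1_card big_mkcond.
  by apply: eq_bigr => x _; rewrite !inE; case: (childless T x); case: ancestor.
rewrite internalE [X in X <= _]cardE leq_add2l big_distrr.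
apply: leq_sum => x _.
have [ux | _] := boolP (ancestor T u x); last by rewrite /= !muln0.
have [/eqP -> | _] := boolP (childless T x); first by rewrite cards0.
by have := T_arity x; rewrite (negPf (ancestor_neq_root ur ux)) addn0 /= !muln1.
Qed.

(* In a tree with [L] leaves and [i] internal nodes, of arity at most [b], there
   are [t] nodes below some node, of which [l] are leaves. *)
Lemma half_nodes_half_leaves b i l L t : 1 < b -> i.-1 * b.-1 + 3 <= L ->
  l <= t -> 2 * t <= L + i -> t <= 1 + b * (t - l) -> 2 * l <= L.
Proof.
move=> b_gt1 L_ge lt t_half t_le.
have [d tE] : exists d, t = l + d by exists (t - l); lia.
have [a bE] : exists a, b = a.+2 by exists (b - 2); lia.
rewrite tE addKn bE /= in L_ge t_half t_le *.
rewrite leqNgt; apply/negP => l_gt.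
have i_le : i * a.+1 + 2 <= L + a.
  by case: i L_ge {t_half} => [|i] /=; rewrite ?mulSn; lia.
nia.
Qed.

Section Conclusion.

Variables (V : finType) (e : rel V) (root : V) (T : rooted_tree e root).
Variable b : nat.
Hypotheses (b_gt1 : 1 < b) (e_degree : max_degree e <= b.+1).
Hypothesis e_minimal : sigma_LL_minimal b.+1 e.
Hypothesis b_lt_leaves : b < #|leaves e|.

Lemma sigma_LL_minimal_card :
  #|V| = #|leaves e| + internal_count b #|leaves e|.
Proof.
have [c [C C_balanced]] := exists_balanced (leaves e) (rooted_tree_is_tree T).
exact: optimal_card C_balanced.
Qed.

Lemma balanced_leaves : balanced T [set: V] -> balanced T (leaves e).
Proof.
move=> nodes_balanced; have cardV := sigma_LL_minimal_card.
have root_kids : 1 < #|kids T root|.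
  by apply: balanced_root_kids_gt1 nodes_balanced; rewrite cardsT cardV; lia.
move=> u ur; rewrite (leavesE root_kids) -leaf_countE -leaf_count_root.
have /andP[L_ge _] := internal_countP b_gt1 b_lt_leaves.
have T_arity : arity_le T b by apply/max_degree_arity_le.
have leaves_le : leaf_count T u <= #|descendants T u|.
  by rewrite leaf_countE subset_leq_card // subsetIr.
rewrite leaf_count_root -leavesE //.
apply: half_nodes_half_leaves b_gt1 L_ge leaves_le _ _; last first.
  exact: card_descendants T_arity ur.
by have := nodes_balanced u ur; rewrite setTI cardsT cardV.
Qed.

Lemma optimal_left_filled : balanced T (leaves e) ->
  exists2 K, 0 < K & left_filled T (before T) b.+1 b K.
Proof.
move=> T_balanced; have T_arity : arity_le T b by apply/max_degree_arity_le.
have L_root := optimal_leaf_count_root b_gt1 b_lt_leaves T_balanced.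
have b_lt_L : b < leaf_count T root by rewrite L_root.
have half := optimal_leaf_balanced b_gt1 b_lt_leaves T_balanced.
have T_tight : crowns_tight T b by apply: optimal_crowns_tight.
have [K T_layered] := tight_layered b_gt1 T_arity b_lt_L half T_tight.
exists K; first exact: layered_gt0 T_layered.
apply: layered_left_filled => // u w.
exact: full_or_bare b_gt1 T_arity b_lt_L half T_tight _ _ _ T_layered.
Qed.

End Conclusion.

Theorem theorem2 (Delta : nat) (V : finType) (e : rel V) (v : V)
    (hDelta : 3 <= Delta) (hT : is_tree e) (hdeg : max_degree e = Delta)
    (hmin : forall (V' : finType) (e' : rel V'),
       is_tree e' -> max_degree e' <= Delta -> #|leaves e'| = #|leaves e| ->
       sigma_LL e <= sigma_LL e')
    (hv : central e v) :
  exists lt : rel V,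
    in_family Delta Delta e v lt /\
    forall u : V, u != v ->
      exists hu : u \in subtree e v u,
        in_family Delta.-1 Delta (induced e (subtree e v u))
          (exist (fun w => w \in subtree e v u) u hu)
          (induced lt (subtree e v u)).
Proof.
case: Delta hDelta hdeg hmin => // b b_gt1 hdeg e_minimal.
have b_gt0 : 0 < b := ltnW b_gt1.
have e_degree : max_degree e <= b.+1 by rewrite hdeg.
have b_lt_leaves : b < #|leaves e|.
  by rewrite -hdeg max_degree_le_leaves // hdeg.
pose T := rooted_tree_of v hT.
have T_balanced : balanced T (leaves e).
  have nodes_balanced := central_balanced T hv.
  exact: balanced_leaves b_gt1 e_degree e_minimal b_lt_leaves nodes_balanced.
have [K K_gt0 T_filled] :=
  optimal_left_filled b_gt1 e_degree e_minimal b_lt_leaves T_balanced.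
have T_ordered := before_left_to_right T.
exists (before T); split=> [|u uv].
  apply: filled_in_family T_ordered T_filled _ _ => // K0.
  by rewrite K0 in K_gt0.
have hu : u \in subtree e v u by rewrite (in_subtree T) ancestor_refl.
exists hu; have S_ordered := subtree_left_to_right T hu T_ordered.
exact: filled_in_family S_ordered (subtree_left_filled hu uv T_filled) _ _.
Qed.
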